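(* Let $j\in\{3,4,6,7\}$ and let $G$ be a tricyclic graph on $n$ vertices having exactly $j$ simple cycles. If $G$ has maximum signless Laplacian Estrada index $SLEE$ among all tricyclic graphs on $n$ vertices having exactly $j$ simple cycles, then $G\cong H_j^n$.
   Context: All graphs are finite, undirected and simple. A tricyclic graph is a connected graph with $n$ vertices and $m=n+2$ edges (cyclomatic number $m-n+1=3$). A simple cycle is a cycle (as a subgraph) in which no vertices are repeated. For a graph $G$ on $n$ vertices, the signless Laplacian matrix is $\mathbf{Q}(G)=\mathbf{D}(G)+\mathbf{A}(G)$, where $\mathbf{D}(G)$ is the diagonal matrix of vertex degrees and $\mathbf{A}(G)$ is the adjacency matrix. If $q_1,\dots,q_n$ are the eigenvalues of $\mathbf{Q}(G)$ (with multiplicity), then $SLEE(G)=\sum_{i=1}^n e^{q_i}$. The graphs $H_j^n$ (on $n$ vertices) are: - $H_3^n$ ($n\ge 7$): three triangles sharing exactly one common vertex $z$ (and otherwise disjoint), with $n-7$ pendent vertices attached to $z$. - $H_4^n$ ($n\ge 6$): the graph on vertices $z,a_1,a_2,a_3,a_4,a_5$ with edges $za_1,za_2,za_3,za_4,za_5,a_1a_2,a_2a_3,a_4a_5$, with $n-6$ pendent vertices attached to $z$. - $H_6^n$ ($n\ge 5$): the graph on vertices $z,y,a_1,a_2,a_3$ with edges $zy$, $za_i$, $ya_i$ ($i=1,2,3$), with $n-5$ pendent vertices attached to $z$. - $H_7^n$ ($n\ge 4$): the complete graph $K_4$ with $n-4$ pendent vertices attached to one of its vertices. *)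

(* Defs.v *)
From mathcomp Require Import all_boot all_order all_algebra.
From mathcomp Require Import reals sequences exp.
From mathcomp.real_closed Require complex.

Set Implicit Arguments.
Unset Strict Implicit.
Unset Printing Implicit Defensive.

Import Order.TTheory GRing.Theory Num.Theory.
Local Open Scope ring_scope.

Record sgraph (n : nat) := SGraph {
  adj :> rel 'I_n;
  adj_sym : symmetric adj;
  adj_irrefl : irreflexive adj
}.

Definition edges n (G : sgraph n) : {set {set 'I_n}} :=
  [set [set p.1; p.2] | p : 'I_n * 'I_n & G p.1 p.2].

Definition connected_graph n (G : sgraph n) : Prop :=
  forall x y : 'I_n, connect G x y.

Definition tricyclic n (G : sgraph n) : Prop :=
  connected_graph G /\ #|edges G| = (n + 2)%N.

(* A simple cycle is identified with its edge set, so that vertex sequences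
   differing by a rotation or a reversal count only once. *)
Definition cycle_edges n (s : seq 'I_n) : {set {set 'I_n}} :=
  [set [set x; next s x] | x in s].

(* A cycle has no repeated vertex, hence at most n vertices. *)
Definition simple_cycles n (G : sgraph n) : {set {set {set 'I_n}}} :=
  \bigcup_(k < n.+1 | (3 <= k)%N)
    [set cycle_edges s | s : k.-tuple 'I_n & ucycleb G s].

Definition graph_iso n (G H : sgraph n) : Prop :=
  exists2 f : 'I_n -> 'I_n, bijective f & forall x y, G x y = H (f x) (f y).

Lemma simple_cyclesP n (G : sgraph n) (C : {set {set 'I_n}}) :
  reflect (exists s : seq 'I_n,
             [/\ (3 <= size s)%N, cycle G s, uniq s & C = cycle_edges s])
          (C \in simple_cycles G).
Proof.
apply: (iffP bigcupP) => [[k k3 /imsetP[s]]|[s [s3 cs us ->]]].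
  by rewrite inE => /andP[cs us] ->; exists s; rewrite size_tuple.
have sn : (size s < n.+1)%N.
  by rewrite ltnS -[n in (_ <= n)%N]card_ord -(card_uniqP us) max_card.
exists (Ordinal sn) => //; apply/imsetP; exists (in_tuple s) => //.
by rewrite inE /ucycleb cs us.
Qed.

Section SignlessLaplacian.
Variables (R : realType) (n : nat) (G : sgraph n).

Definition degree (x : 'I_n) : nat := #|[set y | G x y]|.

Definition degree_mx : 'M[R]_n := diag_mx (\row_i (degree i)%:R).

Definition adjacency_mx : 'M[R]_n := \matrix_(i, j) (G i j)%:R.

Definition signless_laplacian : 'M[R]_n := degree_mx + adjacency_mx.

Lemma signless_laplacian_sym : signless_laplacian^T = signless_laplacian.
Proof.
apply/matrixP=> i j; rewrite !mxE adj_sym.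
by case: (eqVneq i j) => [->|]; rewrite ?eqxx // eq_sym => /negbTE ->.
Qed.

End SignlessLaplacian.

Lemma char_poly_conj (F : fieldType) n (P D : 'M[F]_n) : P \in unitmx ->
  char_poly (invmx P *m D *m P) = char_poly D.
Proof.
move=> Pu; rewrite /char_poly.
have -> : char_poly_mx (invmx P *m D *m P) =
  map_mx polyC (invmx P) *m char_poly_mx D *m map_mx polyC P.
  rewrite /char_poly_mx mulmxBr mulmxBl -!map_mxM /=; congr (_ - _).
  by rewrite mul_mx_scalar -scalemxAl -map_mxM mulVmx // map_mx1 scalemx1.
rewrite !det_mulmx mulrAC -det_mulmx -map_mxM mulVmx //.
by rewrite map_mx1 det1 mul1r.
Qed.

Section RealSpectrum.
Import complex.
Local Open Scope complex_scope.

Lemma symmetric_char_poly_split (R : realType) n (A : 'M[R]_n) : A^T = A ->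
  exists q : n.-tuple R, char_poly A == \prod_(x <- q) ('X - x%:P).
Proof.
move=> AT; pose toC : {rmorphism R -> R[i]} := real_complex R.
pose B := map_mx toC A.
have Bh : B \is hermsymmx.
  apply: realsym_hermsym.
    by apply/is_hermitianmxP; rewrite expr0 scale1r map_mx_id // map_trmx AT.
  by apply/mxOverP=> i j; rewrite mxE complex_real.
have [/orthomx_spectralP BE /mxOverP dr] :=
  (hermitian_normalmx Bh, hermitian_spectral_diag_real Bh).
exists [tuple Re (spectral_diag B 0 i) | i < n].
apply/eqP/(map_poly_inj toC); rewrite map_char_poly -/B [X in char_poly X]BE.
rewrite char_poly_conj ?spectral_unit // char_poly_trig ?diag_mx_is_trig //.
rewrite rmorph_prod big_map big_enum; apply: eq_bigr => i _.
by rewrite rmorphB /= map_polyX map_polyC /= mxE eqxx mulr1n RRe_real ?dr.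
Qed.

End RealSpectrum.

(* The eigenvalues of Q(G) with multiplicity, in an arbitrary order. *)
Definition spectrum (R : realType) n (G : sgraph n) : n.-tuple R :=
  xchoose (symmetric_char_poly_split (signless_laplacian_sym R G)).

Definition SLEE (R : realType) n (G : sgraph n) : R :=
  \sum_(q <- spectrum R G) expR q.

Lemma spectrumP (R : realType) n (G : sgraph n) :
  char_poly (signless_laplacian R G) = \prod_(q <- spectrum R G) ('X - q%:P).
Proof. exact/eqP/(xchooseP (symmetric_char_poly_split _)). Qed.

Lemma SLEE_eigenvalues (R : realType) n (G : sgraph n) (qs : seq R) :
  char_poly (signless_laplacian R G) = \prod_(q <- qs) ('X - q%:P) ->
  SLEE R G = \sum_(q <- qs) expR q.
Proof. by rewrite spectrumP => /prod_XsubC_eq; apply: perm_big. Qed.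

(* Pairs with an entry outside [0, n) are ignored. *)
Section GraphOfEdges.
Variables (n : nat) (es : seq (nat * nat)).

Definition edge_rel (x y : 'I_n) : bool :=
  (x != y) && (((x : nat, y : nat) \in es) || ((y : nat, x : nat) \in es)).

Lemma edge_rel_sym : symmetric edge_rel.
Proof. by move=> x y; rewrite /edge_rel eq_sym orbC. Qed.

Lemma edge_rel_irrefl : irreflexive edge_rel.
Proof. by move=> x; rewrite /edge_rel eqxx. Qed.

Definition graph_of_edges : sgraph n := SGraph edge_rel_sym edge_rel_irrefl.

End GraphOfEdges.

(* Vertices k, ..., n - 1 are pendent at vertex 0, which plays the role of z. *)
Definition pendent_edges (k n : nat) : seq (nat * nat) :=
  [seq (0%N, i) | i <- iota k (n - k)].

(* Three triangles sharing vertex 0 (meaningful for n >= 7). *)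
Definition H3_graph n : sgraph n := graph_of_edges n
  ([:: (0, 1); (0, 2); (1, 2); (0, 3); (0, 4); (3, 4); (0, 5); (0, 6); (5, 6)]
   ++ pendent_edges 7 n)%N.

(* z = 0, a_i = i (meaningful for n >= 6). *)
Definition H4_graph n : sgraph n := graph_of_edges n
  ([:: (0, 1); (0, 2); (0, 3); (0, 4); (0, 5); (1, 2); (2, 3); (4, 5)]
   ++ pendent_edges 6 n)%N.

(* z = 0, y = 1, a_i = i + 1 (meaningful for n >= 5). *)
Definition H6_graph n : sgraph n := graph_of_edges n
  ([:: (0, 1); (0, 2); (0, 3); (0, 4); (1, 2); (1, 3); (1, 4)]
   ++ pendent_edges 5 n)%N.

(* K_4 on the vertices 0, ..., 3 (meaningful for n >= 4). *)
Definition H7_graph n : sgraph n := graph_of_edges n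
  ([:: (0, 1); (0, 2); (0, 3); (1, 2); (1, 3); (2, 3)]
   ++ pendent_edges 4 n)%N.

(* Only the values j = 3, 4, 6, 7 are meaningful. *)
Definition H_graph (j n : nat) : sgraph n :=
  match j with
  | 3 => H3_graph n
  | 4 => H4_graph n
  | 6 => H6_graph n
  | 7 => H7_graph n
  | _ => graph_of_edges n [::]
  end.

(* Main.v *)
(* Kelmans' transformation K(G; u, v) moves to u every neighbour of v that is
   not already adjacent to u. In the orthonormal basis
   (e_u + e_v)/sqrt 2, (e_u - e_v)/sqrt 2, e_w (w <> u, v), the signless Laplacian
   of K(G; u, v) dominates entrywise the absolute value of that of G, so all
   spectral moments grow and SLEE strictly increases unless the neighbourhoods of
   u and v are nested. If u and v are adjacent, the transformation keeps the graph
   tricyclic and does not increase the number of simple cycles. When no adjacent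
   pair can be improved, a vertex z of maximum degree is adjacent to all others,
   and removing z leaves three edges, which form one of
     3 K_2 (3 cycles), P_3 + K_2 (4), P_4 (6), K_{1,3} (6), K_3 (7).
   Further Kelmans moves give SLEE(3 K_2) < SLEE(P_3 + K_2) < SLEE(P_4)
   < SLEE(K_{1,3}), and K_{1,3} and K_3 give cospectral graphs; hence no tricyclic
   graph with at most j cycles has a larger SLEE than H_j. *)
Require Import Defs.
From mathcomp Require Import all_boot all_order all_algebra perm.
From mathcomp Require Import boolp classical_sets functions reals topology normedtype.
From mathcomp Require Import sequences exp fintype fingraph finset ring lra zify.
From mathcomp.real_closed Require complex.

Set Implicit Arguments.
Unset Strict Implicit.
Unset Printing Implicit Defensive.

Import Order.TTheory GRing.Theory Num.Theory.
Import numFieldNormedType.Exports.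

(** * Spectral moments and SLEE *)

Local Open Scope ring_scope.

Section Traces.
Import complex.
Local Open Scope complex_scope.

(** Kelmans' move along an edge can destroy cycles, so the reduction ends at a cone with at most j
    cycles, while maximality speaks only of graphs with exactly j. The order of SLEE along the five
    cones therefore has to agree with the order 3, 4, 6, 6, 7 of their cycle counts: from a cone
    with too few cycles one climbs until the count is j. Two coincidences shape the climb. P_4 and
    K_{1,3} both give 6 cycles, so that step must be strict in order to exclude P_4. K_{1,3} and K_3
    give equal SLEE, so no strictly improving move links them and a separate spectral argument is
    required; equality does no harm, since a cone with 6 cycles is no competitor when j = 7 and the
    strict gain comes from the reduction itself. Strictness is read off from tr Q^2, which amounts
    to the sum of the squared degrees; the same quantity makes the reduction terminate. *)

Lemma conjmx_exp (F : fieldType) n (P D : 'M[F]_n) k : P \in unitmx ->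
  (invmx P *m D *m P) ^+ k = invmx P *m (D ^+ k) *m P.
Proof.
move=> Pu; elim: k => [|k IHk]; first by rewrite !expr0 mulmx1 mulVmx.
by rewrite !exprS IHk -!mulmxE !mulmxA -!(mulmxA _ P (invmx P)) mulmxV // mulmx1.
Qed.

Lemma mxtrace_conj (F : fieldType) n (P D : 'M[F]_n) : P \in unitmx ->
  \tr (invmx P *m D *m P) = \tr D.
Proof. by move=> Pu; rewrite mxtrace_mulC mulmxA mulmxV // mul1mx. Qed.

Lemma diag_mx_exp (F : fieldType) n (d : 'rV[F]_n) k :
  (diag_mx d) ^+ k = diag_mx (\row_i d 0 i ^+ k).
Proof.
elim: k => [|k IHk].
  by rewrite expr0; apply/matrixP=> i j; rewrite !mxE expr0.
rewrite exprS IHk -mulmxE mul_diag_mx; apply/matrixP=> i j; rewrite !mxE.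
by rewrite mulrnAr exprS; case: eqP => [->|].
Qed.

Lemma mxtrace_exp_spectrum (R : realType) n (G : sgraph n) k :
  \tr (signless_laplacian R G ^+ k) = \sum_(q <- spectrum R G) q ^+ k.
Proof.
set Q := signless_laplacian R G.
pose toC : {rmorphism R -> R[i]} := real_complex R.
pose B := map_mx toC Q.
have Bh : B \is hermsymmx.
  apply: realsym_hermsym.
    by apply/is_hermitianmxP; rewrite expr0 scale1r map_mx_id // map_trmx
      signless_laplacian_sym.
  by apply/mxOverP=> i j; rewrite mxE complex_real.
have /orthomx_spectralP BE := hermitian_normalmx Bh.
have Bk : map_mx toC (Q ^+ k) = B ^+ k by rewrite rmorphXn.
apply: (fmorph_inj toC).
rewrite -trace_map_mx Bk BE conjmx_exp ?spectral_unit //.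
rewrite mxtrace_conj ?spectral_unit // diag_mx_exp mxtrace_diag rmorph_sum.
under eq_bigr do rewrite mxE.
under [RHS]eq_bigr do rewrite rmorphXn.
rewrite -(big_map toC xpredT (fun z => z ^+ k)).
rewrite -(big_map (fun i => spectral_diag B 0 i) xpredT (fun z => z ^+ k)).
(* The diagonal of the unitary diagonalisation over [R[i]] and the chosen [spectrum] are two lists
   of roots of one split polynomial, so they agree up to order. *)
apply: perm_big; apply: prod_XsubC_eq.
rewrite !big_map.
transitivity (char_poly B).
  rewrite [RHS](congr1 char_poly BE) char_poly_conj ?spectral_unit //.
  rewrite char_poly_trig ?diag_mx_is_trig //.
  by apply: eq_bigr => i _; rewrite mxE eqxx mulr1n.
rewrite -map_char_poly spectrumP rmorph_prod; apply: eq_bigr => q _.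
by rewrite rmorphB /= map_polyX map_polyC.
Qed.

End Traces.

(** Summing the exponential series over the finitely many eigenvalues leaves only traces of powers,
    which can be compared entrywise without knowing any eigenvalue. *)
Lemma SLEE_series (R : realType) n (G : sgraph n) :
  (series (fun k => \tr (signless_laplacian R G ^+ k) / k`!%:R) @ \oo
    --> SLEE R G)%classic.
Proof.
have -> : series (fun k => \tr (signless_laplacian R G ^+ k) / k`!%:R) =
    \sum_(q <- spectrum R G) series (exp_coeff q).
  apply/funext => K; rewrite fct_sumE /series /= exchange_big /=.
  by apply: eq_bigr => k _; rewrite mxtrace_exp_spectrum mulr_suml.
rewrite /SLEE; elim: (tval (spectrum R G)) => [|q s IHs].
  by rewrite !big_nil; apply: cvg_cst.
by rewrite !big_cons; apply: cvgD => //; apply: is_cvg_series_exp_coeff.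
Qed.

(** A strict inequality could be lost in the limit; here the gap at [m] adds the fixed amount [d] to
    every partial sum that reaches beyond [m]. *)
Lemma SLEE_lt (R : realType) n (G H : sgraph n) m :
    (forall k, \tr (signless_laplacian R G ^+ k)
               <= \tr (signless_laplacian R H ^+ k)) ->
    \tr (signless_laplacian R G ^+ m) < \tr (signless_laplacian R H ^+ m) ->
  SLEE R G < SLEE R H.
Proof.
move=> le_GH lt_GH.
pose d := (\tr (signless_laplacian R H ^+ m)
           - \tr (signless_laplacian R G ^+ m)) / m`!%:R.
have d0 : 0 < d by rewrite divr_gt0 ?subr_gt0 // ltr0n fact_gt0.
suff : SLEE R G + d <= SLEE R H by apply: lt_le_trans; rewrite ltrDl.
apply: (ler_cvg_to (cvgD (@SLEE_series R n G) (cvg_cst d)) (@SLEE_series R n H)).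
near=> K.
have mK : (m < K)%N by near: K; exact: nbhs_infty_gt.
rewrite /series /= !big_mkord [leRHS](bigD1 (Ordinal mK)) //=.
rewrite [X in X + _ <= _]big_mkord [X in X + _ <= _](bigD1 (Ordinal mK)) //= addrAC.
apply: lerD; first by rewrite /d mulrBl addrC subrK.
by apply: ler_sum => k _; rewrite ler_wpM2r // invr_ge0.
Unshelve. all: by end_near. Qed.

Lemma SLEE_intertwine (R : realType) n (G H : sgraph n) (S : 'M[R]_n) :
    S \in unitmx -> S *m signless_laplacian R G = signless_laplacian R H *m S ->
  SLEE R G = SLEE R H.
Proof.
move=> Su SG; apply: SLEE_eigenvalues; rewrite -spectrumP.
by rewrite -(char_poly_conj (signless_laplacian R H) Su) -mulmxA -SG mulmxA
  mulVmx // mul1mx.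
Qed.

(** * Kelmans' transformation *)

Section Kelmans.
Variables (n : nat) (G : sgraph n) (u v : 'I_n).

Let moved (x w : 'I_n) := if x == u then G u w || G v w else G u w && G v w.

(** Outside {u, v}, [u] receives the union of the two neighbourhoods and [v] their intersection. The
    last branch keeps the edge [uv] and all edges avoiding both vertices. *)
Definition kelmans_rel (x y : 'I_n) : bool :=
  match x \in [:: u; v], y \in [:: u; v] with
  | true, false => moved x y
  | false, true => moved y x
  | _, _ => G x y
  end.

Lemma kelmans_sym : symmetric kelmans_rel.
Proof.
by move=> x y; rewrite /kelmans_rel; do 2 case: (_ \in _) => //; apply: adj_sym.
Qed.

Lemma kelmans_irrefl : irreflexive kelmans_rel.
Proof. by move=> x; rewrite /kelmans_rel; case: (_ \in _) => //; apply: adj_irrefl. Qed.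

Definition kelmans : sgraph n := SGraph kelmans_sym kelmans_irrefl.

Lemma kelmans_out x y : x \notin [:: u; v] -> y \notin [:: u; v] ->
  kelmans x y = G x y.
Proof. by rewrite /= /kelmans_rel => /negbTE-> /negbTE->. Qed.

Lemma kelmans_uv : kelmans u v = G u v.
Proof. by rewrite /= /kelmans_rel !inE !eqxx orbT. Qed.

Lemma kelmans_u w : w \notin [:: u; v] -> kelmans u w = G u w || G v w.
Proof. by rewrite /= /kelmans_rel => /negbTE->; rewrite !inE /moved !eqxx. Qed.

Lemma kelmans_v w : u != v -> w \notin [:: u; v] -> kelmans v w = G u w && G v w.
Proof.
by move=> uv; rewrite /= /kelmans_rel => /negbTE->;
  rewrite !inE /moved !eqxx orbT eq_sym (negbTE uv).
Qed.

End Kelmans.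

Lemma degree_sum n (G : sgraph n) x : degree G x = (\sum_y G x y)%N.
Proof. by rewrite /degree cardsE -sum1_card big_mkcond. Qed.

Section KelmansDegree.
Variables (n : nat) (G : sgraph n) (u v : 'I_n).
Hypothesis uv : u != v.
Let K := kelmans G u v.

Let out_uv w : (w \notin [:: u; v]) = (w != u) && (w != v).
Proof. by rewrite !inE negb_or. Qed.

Lemma degree_split (H : sgraph n) x : degree H x =
  (H x u + H x v + \sum_(w | w \notin [:: u; v]) H x w)%N.
Proof.
rewrite degree_sum (bigD1 u) //= (bigD1 v) ?(eq_sym v) //= addnA; congr (_ + _)%N.
by apply: eq_bigl => w; rewrite out_uv.
Qed.

Lemma degree_kelmans_out w : w \notin [:: u; v] -> degree K w = degree G w.
Proof.
move=> wuv; rewrite !degree_split (adj_sym K w u) (adj_sym K w v) (adj_sym G w u).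
rewrite (adj_sym G w v) kelmans_u // kelmans_v //.
congr (_ + _)%N; first by do 2 case: (G _ _).
by apply: eq_bigr => x xuv; rewrite kelmans_out.
Qed.

Lemma degree_kelmansD : (degree K u + degree K v = degree G u + degree G v)%N.
Proof.
rewrite !degree_split !adj_irrefl (adj_sym K v) (adj_sym G v u) kelmans_uv.
rewrite !addn0 !add0n addnACA [RHS]addnACA.
congr (_ + _)%N; rewrite -!big_split; apply: eq_bigr => w wuv.
change (K u w + K v w = G u w + G v w)%N.
by rewrite kelmans_u // kelmans_v //; do 2 case: (G _ _).
Qed.

Lemma leq_degree_kelmans x : x \in [:: u; v] -> (degree G x <= degree K u)%N.
Proof.
move=> xuv; rewrite !degree_split kelmans_uv adj_irrefl leq_add //.
  by move: xuv; rewrite !inE => /pred2P[] ->;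
    rewrite !adj_irrefl // (adj_sym G v) addn0 add0n.
apply: leq_sum => w wuv; rewrite kelmans_u //.
by move: xuv; rewrite !inE => /pred2P[] ->; do 2 case: (G _ _).
Qed.

Lemma ltn_degree_kelmans x y w : x \in [:: u; v] -> y \in [:: u; v] ->
  w \notin [:: u; v] -> ~~ G x w -> G y w -> (degree G x < degree K u)%N.
Proof.
move=> xuv yuv wuv xw yw; rewrite !degree_split kelmans_uv adj_irrefl.
rewrite (bigD1 w) // [X in (_ < _ + X)%N](bigD1 w) // (negbTE xw) kelmans_u //.
have -> : (G u w || G v w) = true.
  by move: yuv yw; rewrite !inE => /pred2P[] -> ->; rewrite ?orbT.
pose P i := (i \notin [:: u; v]) && (i != w).
change (G x u + G x v + (0 + \sum_(i | P i) G x i)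
        < G u v + (1 + \sum_(i | P i) K u i))%N.
rewrite add0n add1n addnS ltnS leq_add //.
  by move: xuv; rewrite !inE => /pred2P[] ->;
    rewrite !adj_irrefl // (adj_sym G v) addn0.
apply: leq_sum => z /andP[zuv _]; rewrite kelmans_u //.
by move: xuv; rewrite !inE => /pred2P[] ->; do 2 case: (G _ _).
Qed.

End KelmansDegree.

Lemma mulmx_sum_norm_le (R : realDomainType) n (A A' B B' : 'M[R]_n) :
    (forall i j, `|A i j| <= A' i j) -> (forall i j, `|B i j| <= B' i j) ->
  forall i j, `|(A *m B) i j| <= (A' *m B') i j.
Proof.
move=> AA' BB' i j; rewrite !mxE; apply: le_trans (ler_norm_sum _ _ _) _.
by apply: ler_sum => k _; rewrite normrM ler_pM.
Qed.

Lemma mxtrace_exp_norm_le (R : realDomainType) n (A B : 'M[R]_n) k :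
  (forall i j, `|A i j| <= B i j) -> \tr (A ^+ k) <= \tr (B ^+ k).
Proof.
move=> AB.
suff le_k i j : `|(A ^+ k) i j| <= (B ^+ k) i j.
  by apply: ler_sum => i _; apply: le_trans (le_k i i); apply: ler_norm.
elim: k i j => [|k IHk] i j; first by rewrite !expr0 !mxE normr_nat.
by rewrite !exprS; apply: mulmx_sum_norm_le.
Qed.

Lemma signless_laplacianE (R : realType) n (G : sgraph n) i j :
  signless_laplacian R G i j = (if i == j then degree G i else G i j)%:R.
Proof.
rewrite !mxE; case: eqP => [->|_]; last by rewrite mulr0n add0r.
by rewrite adj_irrefl addr0 mulr1n.
Qed.

(** The lowest moment that can detect a Kelmans move: the moments of order 0 and 1 are n and the
    degree sum, both unchanged by it. *)
Lemma mxtrace_signless_laplacian2 (R : realType) n (G : sgraph n) :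
  \tr (signless_laplacian R G ^+ 2) = (\sum_x (degree G x ^ 2 + degree G x))%:R.
Proof.
rewrite natr_sum; apply: eq_bigr => i _; rewrite expr2 -mulmxE mxE (bigD1 i) //=.
rewrite signless_laplacianE eqxx natrD natrX expr2; congr (_ + _).
rewrite degree_sum natr_sum [RHS](bigD1 i) //= adj_irrefl add0r.
apply: eq_bigr => j ji; rewrite !signless_laplacianE (eq_sym i) (negbTE ji).
by rewrite (adj_sym G j) -natrM; case: (G i j).
Qed.

(* The base change to (e_u + e_v)/sqrt 2, (e_u - e_v)/sqrt 2, e_w. In that basis
   Kelmans' transformation turns each entry a_uw - a_vw into its absolute value
   and keeps each a_uw + a_vw. *)
Section HadamardBasis.
Variables (R : realType) (n : nat) (u v : 'I_n).
Hypothesis uv : u != v.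
Let c : R := (Num.sqrt 2)^-1.

Definition hadamard_mx : 'M[R]_n := \matrix_(i, j)
  if i == u then c *+ (j \in [:: u; v])
  else if i == v then c *+ (j == u) - c *+ (j == v) else (i == j)%:R.
Local Notation T := hadamard_mx.

Let vu : v == u = false. Proof. by rewrite eq_sym (negbTE uv). Qed.
Let cc : c * c = 2^-1.
Proof. by rewrite -invfM -expr2 sqr_sqrtr // ler0n. Qed.

Lemma sum_at_uv (f : 'I_n -> R) : (forall w, w \notin [:: u; v] -> f w = 0) ->
  \sum_w f w = f u + f v.
Proof.
move=> f0; rewrite (bigD1 u) //= (bigD1 v) ?vu //= big1 ?addr0 // => w.
by move=> /andP[wu wv]; apply: f0; rewrite !inE negb_or wu.
Qed.

Lemma mul_hadamard_mx (X : 'M[R]_n) i j : (T *m X) i j =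
  if i == u then c * (X u j + X v j)
  else if i == v then c * (X u j - X v j) else X i j.
Proof.
rewrite mxE; under eq_bigr do rewrite mxE.
case: eqP => _.
  rewrite sum_at_uv => [|w /negbTE->]; last by rewrite mulr0n mul0r.
  by rewrite !inE !eqxx orbT mulr1n mulrDr.
case: eqP => _.
  rewrite sum_at_uv => [|w]; last first.
    by rewrite !inE negb_or => /andP[/negbTE-> /negbTE->]; rewrite subrr mul0r.
  by rewrite !eqxx vu (negbTE uv) !mulr0n subr0 sub0r mulr1n mulNr mulrBr.
rewrite (bigD1 i) //= eqxx mul1r big1 ?addr0 // => k.
by rewrite eq_sym => /negbTE->; rewrite mul0r.
Qed.

Lemma mul_mx_hadamard (X : 'M[R]_n) i j : (X *m T) i j =
  if j == u then c * (X i u + X i v)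
  else if j == v then c * (X i u - X i v) else X i j.
Proof.
have T0 w k : w \notin [:: u; v] -> T w k = (w == k)%:R.
  by rewrite mxE !inE negb_or => /andP[/negbTE-> /negbTE->].
rewrite mxE; case: eqP => [->|/eqP/negbTE ju].
  rewrite sum_at_uv => [|w wuv]; last first.
    rewrite T0 //; move: wuv; rewrite !inE negb_or => /andP[/negbTE-> _].
    by rewrite mulr0.
  by rewrite !mxE !inE !eqxx vu (negbTE uv) mulr1n mulr0n subr0 -mulrDl mulrC.
case: eqP => [->|/eqP/negbTE jv].
  rewrite sum_at_uv => [|w wuv]; last first.
    rewrite T0 //; move: wuv; rewrite !inE negb_or => /andP[_ /negbTE->].
    by rewrite mulr0.
  by rewrite !mxE !inE !eqxx orbT vu mulr1n mulr0n sub0r mulrN -mulrBl mulrC.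
rewrite (bigD1 j) //= T0 ?inE ?ju ?jv // eqxx mulr1 big1 ?addr0 // => k /negbTE kj.
rewrite mxE !inE ju jv subrr mulr0n kj; by case: ifP => _; [|case: ifP => _]; rewrite mulr0.
Qed.

Lemma hadamard_mx2 : T *m T = 1%:M.
Proof.
apply/matrixP => i j; rewrite mul_hadamard_mx !mxE !eqxx vu !inE.
have simp := (eqxx, vu, negbTE uv, mulr1n, mulr0n, orbT).
case: (eqVneq i u) => [->|iu].
  case: (eqVneq j u) => [->|_]; first by rewrite ?simp subr0 mulrDr cc; lra.
  case: (eqVneq j v) => _; rewrite ?simp; ring.
case: (eqVneq i v) => [->|iv]; last by [].
case: (eqVneq j u) => [->|_]; first by rewrite ?simp; ring.
case: (eqVneq j v) => _; last by rewrite ?simp; ring.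
by rewrite ?simp sub0r opprK mulrDr cc; lra.
Qed.

Lemma mxtrace_hadamard (A : 'M[R]_n) k :
  \tr ((T *m A *m T) ^+ k) = \tr (A ^+ k).
Proof.
have /mulmx1_unit[Tu _] := hadamard_mx2.
have TV : T = invmx T.
  by rewrite -[LHS](mulKmx Tu) hadamard_mx2 mulmx1.
by rewrite {1}TV conjmx_exp // mxtrace_conj.
Qed.

(** The hypotheses say that T B T dominates the absolute value of T A T entrywise, with the factors
    [c] and [c * c] cancelled; they are split by which of the row and column indices lie in {u,
    v}. *)
Lemma hadamard_norm_le (A B : 'M[R]_n) :
    (forall i j, i \notin [:: u; v] -> j \notin [:: u; v] -> `|A i j| <= B i j) ->
    (forall i, i \notin [:: u; v] ->
       `|A u i + A v i| <= B u i + B v i /\ `|A u i - A v i| <= B u i - B v i) ->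
    (forall i, i \notin [:: u; v] ->
       `|A i u + A i v| <= B i u + B i v /\ `|A i u - A i v| <= B i u - B i v) ->
    `|A u u + A u v + A v u + A v v| <= B u u + B u v + B v u + B v v ->
    `|A u u - A u v + A v u - A v v| <= B u u - B u v + B v u - B v v ->
    `|A u u + A u v - A v u - A v v| <= B u u + B u v - B v u - B v v ->
    `|A u u - A u v - A v u + A v v| <= B u u - B u v - B v u + B v v ->
  forall k, \tr (A ^+ k) <= \tr (B ^+ k).
Proof.
move=> ABw ABl ABr ABpp ABpm ABmp ABmm k.
rewrite -[leLHS]mxtrace_hadamard -[leRHS]mxtrace_hadamard.
have c0 : 0 <= c by rewrite invr_ge0 sqrtr_ge0.
have cM x y : `|x| <= y -> `|c * x| <= c * y.
  by move=> xy; rewrite normrM (ger0_norm c0) ler_wpM2l.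
have ccM x y x' y' : x = c * (c * x') -> y = c * (c * y') -> `|x'| <= y' -> `|x| <= y.
  by move=> -> -> xy; apply/cM/cM.
apply: mxtrace_exp_norm_le => i j; rewrite !mul_mx_hadamard !mul_hadamard_mx ?eqxx ?vu.
have out x : x != u -> x != v -> x \notin [:: u; v] by rewrite !inE negb_or => ->.
case: (eqVneq j u) => ju; first case: (eqVneq i u) => iu.
- by apply: ccM ABpp; ring.
- case: (eqVneq i v) => iv; last by apply: cM; case: (ABr i (out _ iu iv)).
  by apply: ccM ABmp; ring.
case: (eqVneq j v) => jv; first case: (eqVneq i u) => iu.
- by apply: ccM ABpm; ring.
- case: (eqVneq i v) => iv; last by apply: cM; case: (ABr i (out _ iu iv)).
  by apply: ccM ABmm; ring.
have {}ju := out _ ju jv.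
case: (eqVneq i u) => iu; first by apply: cM; case: (ABl j ju).
case: (eqVneq i v) => iv; first by apply: cM; case: (ABl j ju).
by apply: ABw => //; apply: out.
Qed.

End HadamardBasis.

(** * Growth of the spectral moments under Kelmans' transformation *)

Section KelmansSLEE.
Variables (R : realType) (n : nat) (G : sgraph n) (u v : 'I_n).
Hypothesis uv : u != v.

(** On the block of [u] and [v], the degree sum is unchanged and the new degree of [u] is at least
    both old ones, so the new difference of degrees dominates the absolute value of the old one. The
    entry d(u) + d(v) - 2 a_uv is unchanged and nonnegative, because a degree is at least any
    adjacency entry of its row. *)
Lemma mxtrace_exp_kelmans k : \tr (signless_laplacian R G ^+ k)
  <= \tr (signless_laplacian R (kelmans G u v) ^+ k).
Proof.
set K := kelmans G u v.
have nb (H : sgraph n) x w : x \in [:: u; v] -> w \notin [:: u; v] ->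
    signless_laplacian R H x w = (H x w)%:R.
  by move=> xuv wuv; rewrite signless_laplacianE; case: eqP wuv => // <-; rewrite xuv.
have nbC (H : sgraph n) x w : x \in [:: u; v] -> w \notin [:: u; v] ->
    signless_laplacian R H w x = (H x w)%:R.
  move=> xuv wuv; rewrite signless_laplacianE adj_sym.
  by case: eqP wuv => // ->; rewrite xuv.
have uin : u \in [:: u; v] by rewrite !inE eqxx.
have vin : v \in [:: u; v] by rewrite !inE eqxx orbT.
have side w : w \notin [:: u; v] ->
    `|(G u w)%:R + (G v w)%:R : R| <= (K u w)%:R + (K v w)%:R /\
    `|(G u w)%:R - (G v w)%:R : R| <= (K u w)%:R - (K v w)%:R.
  move=> wuv; rewrite kelmans_u // kelmans_v //.
  by do 2 case: (G _ _) => /=; split; rewrite ler_norml; apply/andP; split; lra.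
have vu : v == u = false by rewrite eq_sym (negbTE uv).
have dD : (degree K u)%:R + (degree K v)%:R
    = (degree G u)%:R + (degree G v)%:R :> R.
  by rewrite -!natrD (degree_kelmansD _ uv).
have du : (degree G u)%:R <= (degree K u)%:R :> R.
  by rewrite ler_nat leq_degree_kelmans.
have dv : (degree G v)%:R <= (degree K u)%:R :> R.
  by rewrite ler_nat leq_degree_kelmans.
have adj_deg x y : (G x y)%:R <= (degree G x)%:R :> R.
  by rewrite ler_nat degree_sum (bigD1 y) //= leq_addr.
have gu := adj_deg u v; have gv := adj_deg v u.
have Kuv : K u v = G u v by apply: kelmans_uv.
have g0 : 0 <= (G u v)%:R :> R by [].
apply: (hadamard_norm_le uv) => // [i j iuv juv|w wuv|w wuv||||].
- rewrite !signless_laplacianE degree_kelmans_out // kelmans_out //.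
  by rewrite ger0_norm.
- by rewrite !nb //; apply: side.
- by rewrite !nbC //; apply: side.
all: rewrite !signless_laplacianE !eqxx vu (negbTE uv) (adj_sym K v) (adj_sym G v) Kuv.
all: rewrite (adj_sym G v) in gv.
all: by rewrite ler_norml; apply/andP; split; lra.
Qed.

Let sum_uv (f : 'I_n -> nat) : (\sum_(x | x \in [:: u; v]) f x = f u + f v)%N.
Proof.
rewrite -big_uniq /=; last by rewrite inE uv.
by rewrite !big_cons big_nil addn0.
Qed.

Lemma sum_degree_kelmans :
  (\sum_x degree (kelmans G u v) x = \sum_x degree G x)%N.
Proof.
rewrite !(bigID (mem [:: u; v]) xpredT) /=; congr (_ + _)%N; last first.
  by apply: eq_bigr => x xuv; apply: degree_kelmans_out.
by rewrite !sum_uv degree_kelmansD.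
Qed.

(** The two degrees keep their sum while one of them comes to exceed both old values, so convexity
    of the square gives strictness. [x] and [y] witness that neither neighbourhood contains the
    other. *)
Lemma sum_sqr_degree_kelmans x y :
    x \notin [:: u; v] -> y \notin [:: u; v] ->
    G u x -> ~~ G v x -> G v y -> ~~ G u y ->
  (\sum_x degree G x ^ 2 < \sum_x degree (kelmans G u v) x ^ 2)%N.
Proof.
move=> xuv yuv ux vx vy uy.
rewrite !(bigID (mem [:: u; v]) xpredT) /=.
rewrite [X in (_ < _ + X)%N](eq_bigr (fun x => degree G x ^ 2)%N); last first.
  by move=> w wuv; rewrite degree_kelmans_out.
rewrite ltn_add2r.
rewrite !sum_uv.
have uin : u \in [:: u; v] by rewrite !inE eqxx.
have vin : v \in [:: u; v] by rewrite !inE eqxx orbT.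
have := degree_kelmansD G uv.
have := ltn_degree_kelmans uv uin vin yuv uy vy.
have := ltn_degree_kelmans uv vin uin xuv vx ux.
rewrite -!mulnn; nia.
Qed.

Lemma kelmans_SLEE_lt x y :
    x \notin [:: u; v] -> y \notin [:: u; v] ->
    G u x -> ~~ G v x -> G v y -> ~~ G u y ->
  SLEE R G < SLEE R (kelmans G u v).
Proof.
move=> xuv yuv ux vx vy uy; apply: (@SLEE_lt _ _ _ _ 2) mxtrace_exp_kelmans _.
rewrite !mxtrace_signless_laplacian2 ltr_nat !big_split /= sum_degree_kelmans.
by rewrite ltn_add2r (sum_sqr_degree_kelmans xuv yuv).
Qed.

End KelmansSLEE.

Local Close Scope ring_scope.

(** * Edge sets of cycles *)

Lemma set2_eq (T : finType) (a b c d : T) : ([set a; b] == [set c; d]) =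
  (a == c) && (b == d) || (a == d) && (b == c).
Proof.
apply/idP/idP => [/eqP E|/orP[]/andP[/eqP-> /eqP->] //]; last by rewrite setUC.
have: a \in [set c; d] by rewrite -E !inE eqxx.
have: b \in [set c; d] by rewrite -E !inE eqxx orbT.
have: c \in [set a; b] by rewrite E !inE eqxx.
have: d \in [set a; b] by rewrite E !inE eqxx orbT.
rewrite !inE => /pred2P[] ? /pred2P[] ? /pred2P[] ? /pred2P[] ?; subst.
all: by rewrite ?eqxx ?orbT.
Qed.

Lemma mem_edges n (G : sgraph n) x y : ([set x; y] \in edges G) = G x y.
Proof.
apply/imsetP/idP => [[[a b]]|xy]; last by exists (x, y); rewrite // inE.
rewrite inE /= => ab /eqP; rewrite set2_eq.
by case/orP => /andP[/eqP-> /eqP->]; rewrite // adj_sym.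
Qed.

Lemma edgesP n (G : sgraph n) e :
  reflect (exists x y, G x y /\ e = [set x; y]) (e \in edges G).
Proof.
apply: (iffP imsetP) => [[[x y]]|[x [y [xy ->]]]].
  by rewrite inE /= => xy ->; exists x, y.
by exists (x, y); rewrite // inE.
Qed.

Lemma sum_degree n (G : sgraph n) : \sum_x degree G x = #|edges G|.*2.
Proof.
under eq_bigr do rewrite degree_sum.
pose P := [set p : 'I_n * 'I_n | (p.1 < p.2) && G p.1 p.2].
have EP : edges G = [set [set p.1; p.2] | p in P].
  apply/setP => e; apply/edgesP/imsetP => [[x [y [xy ->]]]|[[x y]]].
    have [lt_xy|lt_yx|eq_xy] := ltngtP x y.
    - by exists (x, y); rewrite // inE /= lt_xy.
    - by exists (y, x); rewrite ?inE /= ?lt_yx 1?adj_sym // setUC.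
    by move: xy; rewrite (val_inj eq_xy) adj_irrefl.
  by rewrite inE => /andP[_ xy] ->; exists x, y.
have P_inj : {in P &, injective (fun p => [set p.1; p.2])}.
  move=> [x y] [z t]; rewrite !inE /= => /andP[xy _] /andP[zt _] /eqP.
  rewrite set2_eq => /orP[/andP[/eqP-> /eqP->] //|/andP[/eqP xt /eqP yz]].
  by move: xy zt; rewrite xt yz => /ltn_trans lt /lt; rewrite ltnn.
rewrite EP card_in_imset // -addnn.
have PE (Q : pred ('I_n * 'I_n)) : #|[set p | Q p]| = \sum_x \sum_y Q (x, y).
  rewrite pair_big -sum1_card big_mkcond /=; apply: eq_bigr => -[x y] _.
  by rewrite inE /=; case: (Q _).
rewrite {1}PE; have -> : #|P| = \sum_(x < n) \sum_(y < n) ((y < x) && G x y).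
  rewrite PE exchange_big; apply: eq_bigr => x _; apply: eq_bigr => y _ /=.
  by rewrite adj_sym.
rewrite -big_split; apply: eq_bigr => x _; rewrite -big_split.
apply: eq_bigr => y _ /=; case: (ltngtP x y) => //= [lt_xy|/val_inj->].
  by rewrite addn0.
by rewrite adj_irrefl.
Qed.

Section CycleEdges.
Variable n : nat.
Implicit Types (x y : 'I_n) (s p q : seq 'I_n) (G : sgraph n).

(** Open counterpart of [cycle_edges]: it splits over concatenation and is invariant under reversal,
    which is what rerouting a cycle requires. *)
Fixpoint path_edges x p : {set {set 'I_n}} :=
  if p is y :: p' then [set x; y] |: path_edges y p' else set0.

Lemma path_edges_cat x p q :
  path_edges x (p ++ q) = path_edges x p :|: path_edges (last x p) q.
Proof. by elim: p x => [|y p IHp] x /=; rewrite ?set0U // IHp setUA. Qed.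

Lemma path_edges_rev x p :
  path_edges (last x p) (rev (belast x p)) = path_edges x p.
Proof.
elim: p x => // y p IHp x; rewrite /= rev_cons -cats1 path_edges_cat IHp.
rewrite [in RHS]setUC; congr (_ :|: _).
have -> : last (last y p) (rev (belast y p)) = y.
  by case: p {IHp} => //= z p; rewrite rev_cons last_rcons.
by rewrite /= setU0 setUC.
Qed.

Lemma path_edges_next (f : 'I_n -> 'I_n) x p : fpath f x p ->
  path_edges x p = [set [set y; f y] | y in belast x p].
Proof.
elim: p x => [|y p IHp] x /=.
  by move=> _; apply/setP => e; rewrite inE; apply/esym/imsetP => -[].
case/andP => /eqP fx /IHp->; apply/setP => e; rewrite !inE.
apply/orP/imsetP => [[/eqP->|/imsetP[z zp ->]]|[z]].
- by exists x; rewrite ?inE ?eqxx // fx.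
- by exists z; rewrite ?inE ?zp ?orbT.
rewrite inE => /predU1P[->|zp] ->; first by left; rewrite fx.
by right; apply/imsetP; exists z.
Qed.

Lemma cycle_edges_cons x p : uniq (x :: p) ->
  cycle_edges (x :: p) = path_edges x (rcons p x).
Proof.
move=> us; rewrite (path_edges_next (cycle_next us)).
by rewrite belast_rcons.
Qed.

Lemma cycle_edges_rot i s : uniq s -> cycle_edges (rot i s) = cycle_edges s.
Proof.
move=> us; apply/setP => e.
by apply/imsetP/imsetP => -[x xs ->]; exists x;
  rewrite ?next_rot // ?mem_rot // -(mem_rot i).
Qed.

Lemma mem_cycle_edges s x y : uniq s ->
  ([set x; y] \in cycle_edges s) = (x \in s) && ((y == next s x) || (y == prev s x)).
Proof.
move=> us; apply/imsetP/andP => [[z zs /eqP]|[xs /orP[]/eqP->]].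
- rewrite set2_eq => /orP[]/andP[/eqP-> /eqP->]; first by rewrite zs eqxx.
  by rewrite mem_next zs prev_next // eqxx orbT.
- by exists x.
by exists (prev s x); rewrite ?mem_prev // next_prev // setUC.
Qed.

Lemma cycle_edges_rev s : uniq s -> cycle_edges (rev s) = cycle_edges s.
Proof.
move=> us; apply/setP => e; apply/imsetP/imsetP => -[x xs ->].
  rewrite mem_rev in xs.
  by exists (prev s x); rewrite ?mem_prev // next_prev // next_rev // setUC.
exists (next s x); rewrite ?mem_rev ?mem_next // next_rev //.
by rewrite prev_next // setUC.
Qed.

Lemma cycle_edges_map (h : 'I_n -> 'I_n) s : injective h -> uniq s ->
  cycle_edges (map h s) = [set h @: (e : {set _}) | e in cycle_edges s].
Proof.
move=> h_inj us; rewrite /cycle_edges -imset_comp; apply/setP => e.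
apply/imsetP/imsetP => [[_ /mapP[x xs ->] ->]|[x xs ->]].
  by exists x; rewrite // next_map //= imsetU1 imset_set1.
by exists (h x); rewrite ?map_f // next_map //= imsetU1 imset_set1.
Qed.

Lemma cycle_subset_edges G s : uniq s -> cycle G s = (cycle_edges s \subset edges G).
Proof.
move=> us; apply/idP/subsetP => [cs e /imsetP[x xs ->]|sub].
  by rewrite mem_edges next_cycle.
by apply: cycle_from_next => // x xs; rewrite -mem_edges sub //; apply/imsetP; exists x.
Qed.

Lemma simple_cycle_edges G s : 3 <= size s -> uniq s -> cycle_edges s \subset edges G ->
  cycle_edges s \in simple_cycles G.
Proof.
by move=> s3 us sub; apply/simple_cyclesP; exists s; rewrite cycle_subset_edges.
Qed.

Lemma simple_cycle_sub G C : C \in simple_cycles G -> C \subset edges G.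
Proof. by case/simple_cyclesP => s [_ cs us ->]; rewrite -cycle_subset_edges. Qed.

Lemma next_neq_prev s x : uniq s -> 3 <= size s -> x \in s -> next s x != prev s x.
Proof.
move=> us s3 xs; have [i t Es] := rot_to xs.
rewrite -(next_rot i us) -(prev_rot i us) Es.
have := us; rewrite -(rot_uniq i) Es; move: s3; rewrite -(size_rot i) Es.
case: t {Es} => [|y [|z t]] //= _ /and3P[].
rewrite eqxx !inE !negb_or => /and3P[/negbTE xy /negbTE xz xt] /andP[/negbTE yz yt] _.
rewrite xy xz.
(* With [x] in front, its predecessor is the last element of the list, and length at least 3
   separates this from the successor [y]. *)
suff -> : prev_at x x z t = last z t.
  by apply: contraTneq (mem_last z t) => <-; rewrite inE yz.
by elim: t z xt {xy xz yz yt} => [|w t IHt] z; rewrite /= ?eqxx // inE negb_or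
  => /andP[/negbTE-> /IHt].
Qed.

Lemma path_edges_notin x y z p : x \notin y :: p ->
  [set x; z] \notin path_edges y p.
Proof.
elim: p y => [|w p IHp] y; first by rewrite in_set0.
rewrite !inE !negb_or => /and3P[/negbTE xy /negbTE xw xp].
by rewrite set2_eq xy xw /= IHp // inE negb_or xw.
Qed.

(** Rotation brings [x] to the front and a reversal, if necessary, makes [y] its successor; a cycle
    has only two edges at [x], so [z] comes last. *)
Lemma cycle_edges_at s x y z : uniq s -> 3 <= size s -> y != z ->
    [set x; y] \in cycle_edges s -> [set x; z] \in cycle_edges s ->
  exists t, let s' := x :: y :: rcons t z in
    [/\ uniq s', cycle_edges s' = cycle_edges s & size s' = size s].
Proof.
move=> us s3 yz xy xz.
have xs : x \in s by move: xy; rewrite mem_cycle_edges // => /andP[].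
have [i t0 Es] := rot_to xs; have := us; have := cycle_edges_rot i us.
have := s3; rewrite -(size_rot i) -(rot_uniq i) Es.
case: t0 Es => [|a t1] //; case/lastP: t1 => [|t2 b] // Es _ Ec us1.
have sz : size (x :: a :: rcons t2 b) = size s by rewrite -Es size_rot.
have ab w : [set x; w] \in cycle_edges s -> (w == a) || (w == b).
  rewrite -Ec cycle_edges_cons // rcons_cons /= -cats1 path_edges_cat !inE.
  have /negbTE-> : [set x; w] \notin path_edges a (rcons t2 b).
    by apply: path_edges_notin; case/andP: us1.
  rewrite last_rcons orbF !set2_eq eqxx /=.
  case/orP => [/orP[->|/andP[/eqP<- ->]]|/orP[/andP[/eqP<- ->]|->]] //;
  by rewrite orbT.
have /pred2P[Ey|Ey] := ab _ xy; have /pred2P[Ez|Ez] := ab _ xz.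
- by rewrite Ey Ez eqxx in yz.
- by exists t2; rewrite Ey Ez.
- have Er : rotr 1 (rev (x :: a :: rcons t2 b)) = x :: b :: rcons (rev t2) a.
    by rewrite !rev_cons rev_rcons rotr1_rcons rcons_cons.
  exists (rev t2); cbv zeta; rewrite Ey Ez -Er rotr_uniq rev_uniq us1; split=> //.
    by rewrite /rotr cycle_edges_rot ?rev_uniq // cycle_edges_rev.
  by rewrite size_rot size_rev.
by rewrite Ey Ez eqxx in yz.
Qed.

End CycleEdges.

(** * Simple cycles under Kelmans' transformation *)

Lemma card_edges_kelmans n (G : sgraph n) (u v : 'I_n) : u != v ->
  #|edges (kelmans G u v)| = #|edges G|.
Proof.
by move=> uv; apply: double_inj; rewrite -!sum_degree sum_degree_kelmans.
Qed.

Section KelmansAdjacent.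
Variables (n : nat) (G : sgraph n) (u v : 'I_n).
Hypotheses (uv : u != v) (Guv : G u v).
Let K := kelmans G u v.

Let uin : u \in [:: u; v]. Proof. by rewrite !inE eqxx. Qed.
Let vin : v \in [:: u; v]. Proof. by rewrite !inE eqxx orbT. Qed.
Let vu : v != u. Proof. by rewrite eq_sym. Qed.

(** The edge [uv] survives and keeps [v] attached to [u], so each edge of G at [u] or [v] can be
    replaced by a walk of K through [u]. *)
Lemma connected_kelmans : connected_graph G -> connected_graph K.
Proof.
move=> Gc; have Kuv : K u v by rewrite /K kelmans_uv.
have Ks := sym_connect_sym (adj_sym K).
have Kto w : w \notin [:: u; v] -> G u w || G v w -> K u w.
  by move=> wuv; rewrite kelmans_u.
suff sub : subrel G (connect K) by move=> x y; apply: (connect_sub sub).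
have toU x y : x \in [:: u; v] -> G x y -> connect K u y.
  move=> xuv; case: (boolP (y \in [:: u; v])).
    rewrite !inE => /pred2P[] -> _; first exact: connect0.
    exact: connect1.
  move=> yuv xy; apply: connect1; apply: Kto => //.
  by move: xuv xy; rewrite !inE => /pred2P[] -> ->; rewrite ?orbT.
have UV x : x \in [:: u; v] -> connect K x u.
  by rewrite !inE => /pred2P[] ->; [apply: connect0|rewrite Ks; apply: connect1].
move=> x y xy; case: (boolP (x \in [:: u; v])) => xuv.
  by apply: connect_trans (UV _ xuv) (toU _ _ xuv xy).
case: (boolP (y \in [:: u; v])) => yuv; last first.
  by apply: connect1; rewrite kelmans_out.
rewrite Ks; apply: connect_trans (UV _ yuv) (toU _ _ yuv _).
by rewrite adj_sym.
Qed.

Lemma tricyclic_kelmans : tricyclic G -> tricyclic K.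
Proof. by case=> Gc GE; split; rewrite ?card_edges_kelmans //; apply:
    connected_kelmans. Qed.

Let private w := [&& w != u, w != v & G u w (+) G v w].
Let swap (e : {set 'I_n}) : {set 'I_n} := tperm u v @: e.
(** In a cycle C of K that needs rerouting, both neighbours of [u] are private, and those of [v], if
    it lies on C, are common to [u] and [v]. Hence sending private ends back to [u] and all other
    ends to [v] restores C. *)
Let redirect (e : {set 'I_n}) : {set 'I_n} :=
  if [disjoint [set u; v] & e] then e else
  (if [exists w in e, private w] then u else v) |: (e :\: [set u; v]).

(* A left inverse of the map that sends a cycle C of K to a cycle of G: C itself
   or its image under the transposition (u v) if one of them lies in G; otherwise
   u has in C a neighbour p that was adjacent to u only and a neighbour q that
   was adjacent to v only, and C = u p ... q is sent to u p ... q v or,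
   if C = u p ... v ... q, the part of C from v to q is reversed. *)
Let lift (D : {set {set 'I_n}}) : {set {set 'I_n}} :=
  if D \subset edges K then D
  else if swap @: D \subset edges K then swap @: D
  else redirect @: (D :\ [set u; v]).

Lemma redirect_out x y : x \notin [:: u; v] -> y \notin [:: u; v] ->
  redirect [set x; y] = [set x; y].
Proof.
rewrite !inE !negb_or => /andP[/negbTE xu /negbTE xv] /andP[/negbTE yu /negbTE yv].
by rewrite /redirect disjoints_subset subUset !sub1set !inE !(eq_sym u) !(eq_sym v)
  xu xv yu yv.
Qed.

Lemma redirect_in a w : a \in [:: u; v] -> w \notin [:: u; v] ->
  redirect [set a; w] = [set if private w then u else v; w].
Proof.
move=> auv wuv; rewrite /redirect ifF; last first.
  apply: contraTF auv => /pred0P/(_ a) /=.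
  by rewrite !inE eqxx andbT => ->.
have -> : [set a; w] :\: [set u; v] = [set w].
  apply/setP => x; rewrite !inE; case: (x =P w) => [->|_].
    by move: wuv; rewrite !inE => ->; rewrite orbT.
  rewrite orbF; case: (x =P a) => [->|]; rewrite ?andbF //.
  by move: auv; rewrite !inE => ->.
congr (_ |: _); congr (if _ then _ else _).
apply/existsP/idP => [[x /andP[]]|]; last by exists w; rewrite !inE eqxx orbT.
rewrite !inE => /pred2P[]-> //; rewrite /private.
by move: auv; rewrite !inE => /pred2P[]->; rewrite eqxx ?andbF.
Qed.

Lemma redirect_path_edges x p : {in x :: p, forall y, y \notin [:: u; v]} ->
  redirect @: path_edges x p = path_edges x p.
Proof.
elim: p x => [|y p IHp] x out /=; first by rewrite imset0.
rewrite imsetU1 IHp => [|z zp]; last by apply: out; rewrite inE zp orbT.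
by rewrite redirect_out ?out ?inE ?eqxx ?orbT.
Qed.

Lemma uv_path_edges x p : {in x :: p, forall y, y \notin [:: u; v]} ->
  path_edges x p :\ [set u; v] = path_edges x p.
Proof.
elim: p x => [|y p IHp] x out /=; first by rewrite set0D.
rewrite setDUl IHp => [|z zp]; last by apply: out; rewrite inE zp orbT.
congr (_ :|: _); apply/setDidPl; rewrite disjoints1 !inE set2_eq.
have := out x (mem_head _ _); rewrite !inE !negb_or => /andP[/negbTE xu /negbTE xv].
by rewrite xu xv.
Qed.

Lemma uv_edge1 a w : w \notin [:: u; v] -> [set [set a; w]] :\ [set u; v] = [set [set
    a; w]].
Proof.
move=> wuv; apply/setDidPl; rewrite disjoints1 inE set2_eq.
by move: wuv; rewrite !inE negb_or => /andP[/negbTE-> /negbTE->]; rewrite !andbF.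
Qed.

Lemma kelmans_edge_only e : e \in edges K -> e \notin edges G ->
  exists w, [/\ w \notin [:: u; v], ~~ G u w, G v w & e = [set u; w]].
Proof.
have one a b : a \in [:: u; v] -> b \notin [:: u; v] -> K a b -> ~~ G a b ->
    [/\ b \notin [:: u; v], ~~ G u b, G v b & [set a; b] = [set u; b]].
  move=> + buv; rewrite inE => /predU1P[->|].
    by rewrite kelmans_u // => /orP[->|].
  rewrite inE => /eqP->.
  by rewrite kelmans_v // => /andP[_ ->].
case/edgesP => x [y [xy ->]]; rewrite mem_edges.
case: (boolP (x \in [:: u; v])) => xuv; case: (boolP (y \in [:: u; v])) => yuv nxy.
- by move: xy nxy; rewrite /K /= /kelmans_rel xuv yuv => ->.
- by exists y; apply: one.
- by exists x; rewrite setUC; apply: one => //; rewrite adj_sym.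
by move: nxy; rewrite -(@kelmans_out _ _ u v) // xy.
Qed.

Lemma kelmans_edge_swap e : e \in edges K -> swap e \notin edges G ->
  exists w, [/\ w \notin [:: u; v], G u w, ~~ G v w & e = [set u; w]].
Proof.
have one a b : a \in [:: u; v] -> b \notin [:: u; v] -> K a b ->
    ~~ G (tperm u v a) b ->
    [/\ b \notin [:: u; v], G u b, ~~ G v b & [set a; b] = [set u; b]].
  move=> + buv; rewrite inE => /predU1P[->|].
    by rewrite tpermL kelmans_u // => /orP[-> //|->].
  rewrite inE => /eqP->; rewrite tpermR.
  by rewrite kelmans_v // => /andP[->].
have tpD x : x \notin [:: u; v] -> tperm u v x = x.
  by rewrite !inE negb_or => /andP[xu xv]; rewrite tpermD // eq_sym.
case/edgesP => x [y [xy ->]]; rewrite /swap imsetU1 imset_set1 mem_edges.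
case: (boolP (x \in [:: u; v])) => xuv; case: (boolP (y \in [:: u; v])) => yuv.
- have -> : G (tperm u v x) (tperm u v y) = K x y; last by rewrite xy.
  rewrite /K /= /kelmans_rel xuv yuv.
  by move: xuv yuv; rewrite !inE => /pred2P[]-> /pred2P[]->; rewrite ?tpermL ?tpermR
      ?adj_irrefl // adj_sym.
- by rewrite (tpD y) // => nxy; exists y; apply: one.
- rewrite (tpD x) // adj_sym => nxy.
  by exists x; rewrite setUC; apply: one => //; rewrite adj_sym.
by rewrite !tpD // -(@kelmans_out _ _ u v) // xy.
Qed.

Lemma private_u w : w \notin [:: u; v] -> G u w -> ~~ G v w -> private w.
Proof. by rewrite !inE negb_or /private => /andP[-> ->] -> /negbTE->. Qed.

Lemma private_v w : w \notin [:: u; v] -> G v w -> ~~ G u w -> private w.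
Proof. by rewrite !inE negb_or /private => /andP[-> ->] -> /negbTE->. Qed.

(** In K the vertex [v] keeps only common neighbours. So [qv] is not an edge of K, and neither is
    [vp], the image of [up] under the swap: the first two branches of [lift] fail. *)
Lemma lift_special (C D : {set {set 'I_n}}) p q :
    p \notin [:: u; v] -> G u p -> ~~ G v p -> [set u; p] \in D ->
    q \notin [:: u; v] -> G v q -> ~~ G u q -> [set q; v] \in D ->
  redirect @: (D :\ [set u; v]) = C -> lift D = C.
Proof.
move=> puv up vp Dp quv vq uq Dq; rewrite /lift ifF; last first.
  apply/negP => /subsetP/(_ _ Dq); rewrite mem_edges adj_sym kelmans_v //.
  by rewrite (negbTE uq).
rewrite ifF //; apply/negP => /subsetP/(_ (swap [set u; p])).
rewrite imset_f // => /(_ isT); rewrite /swap imsetU1 imset_set1 tpermL tpermD; last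
    2 first.
- by apply: contraNneq puv => <-.
- by apply: contraNneq puv => <-.
by rewrite mem_edges kelmans_v // (negbTE vp) andbF.
Qed.

Lemma path_edges_kelmans_sub x t : {in x :: t, forall y, y \notin [:: u; v]} ->
  path_edges x t \subset edges K -> path_edges x t \subset edges G.
Proof.
elim: t x => [|y t IHt] x out /=; first by rewrite !sub0set.
rewrite !subUset !sub1set !mem_edges kelmans_out ?out ?inE ?eqxx ?orbT //.
by case/andP=> -> /IHt-> // z zt; apply: out; rewrite inE zt orbT.
Qed.

Lemma simple_cycle_lift C : C \in simple_cycles K ->
  exists2 D, D \in simple_cycles G & lift D = C.
Proof.
move=> CK; have CsubK := simple_cycle_sub CK.
have [s [s3 _ us EC]] := simple_cyclesP _ _ CK.
have [CG|] := boolP (C \subset edges G).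
  by exists C; [rewrite EC simple_cycle_edges // -EC|rewrite /lift CsubK].
case/subsetPn => e Cq /kelmans_edge_only[]; first exact: (subsetP CsubK).
move=> q [quv uq vq Eq]; rewrite {e}Eq in Cq.
have swapK : cancel swap swap.
  by move=> e; rewrite /swap -imset_comp -[RHS]imset_id; apply: eq_imset => x /=;
      rewrite tpermK.
have [swCG|] := boolP (swap @: C \subset edges G).
  exists (swap @: C).
    rewrite EC -cycle_edges_map ?simple_cycle_edges //.
    - by rewrite size_map.
    - by rewrite map_inj_uniq //; apply: perm_inj.
    - by rewrite cycle_edges_map //; [rewrite -EC|apply: perm_inj].
    exact: perm_inj.
  rewrite /lift ifF; last first.
    apply/negP => /subsetP/(_ (swap [set u; q])); rewrite imset_f //.
    move=> /(_ isT); rewrite /swap imsetU1 imset_set1 tpermL tpermD.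
    - by rewrite mem_edges kelmans_v // (negbTE uq).
    - by apply: contraNneq quv => <-.
    by apply: contraNneq quv => <-.
  by rewrite -imset_comp (eq_imset _ swapK) imset_id CsubK.
case/subsetPn => _ /imsetP[e Ce ->] /kelmans_edge_swap[]; first exact: (subsetP CsubK).
move=> p [puv up vp Ep]; rewrite {e}Ep in Ce.
have pq : p != q by apply: contraNneq uq => <-.
rewrite EC in Ce Cq.
have [t [ut Et st]] := cycle_edges_at us s3 pq Ce Cq.
rewrite -{}Et in EC; rewrite -{}st in s3; move=> {s us Ce Cq}.
have [nup nq] : u \notin p :: rcons t q /\ u \notin t.
  by move: ut; rewrite /= inE mem_rcons inE !negb_or => /andP[/and3P[-> -> ->]].
have [vt|vt] := boolP (v \in t); last first.
  set P := path_edges p (rcons t q).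
  have Pout : {in p :: rcons t q, forall y, y \notin [:: u; v]}.
    move=> y yp; rewrite !inE negb_or; apply/andP; split.
      by apply: contraNneq nup => <-.
    apply: contraTneq yp => ->; rewrite inE mem_rcons inE !negb_or vt andbT.
    by move: puv quv; rewrite !inE !negb_or !(eq_sym v) => /andP[_ ->] /andP[_ ->].
  have CE : C = [set u; p] |: (P :|: [set [set q; u]]).
    by rewrite EC cycle_edges_cons // rcons_cons /= -cats1 path_edges_cat
      last_rcons /= setU0.
  have us' : uniq (u :: p :: rcons (rcons t q) v).
    rewrite -!rcons_cons rcons_uniq ut andbT inE negb_or vu /=.
    by apply/negP => /Pout; rewrite !inE eqxx orbT.
  have DE : cycle_edges (u :: p :: rcons (rcons t q) v) =
      [set u; p] |: (P :|: ([set [set q; v]] :|: [set [set v; u]])).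
    rewrite cycle_edges_cons // rcons_cons /= -!cats1 -catA path_edges_cat.
    by rewrite -/(rcons _ _) cats1 last_rcons /= setU0.
  exists (cycle_edges (u :: p :: rcons (rcons t q) v)).
    apply: simple_cycle_edges => //; first by rewrite /= !size_rcons.
    rewrite DE !subUset !sub1set !mem_edges up (adj_sym G q) vq (adj_sym G v) Guv.
    rewrite !andbT path_edges_kelmans_sub //.
    by apply: subset_trans CsubK; rewrite CE; apply/subsetP => e eP; rewrite !inE eP orbT.
  apply: (lift_special puv up vp _ quv vq uq); first by rewrite DE !inE eqxx.
    by rewrite DE !inE eqxx !orbT.
  rewrite DE !setDUl (setUC [set v]) setDv setU0 uv_path_edges // uv_edge1 //.
  rewrite (setUC [set q]) uv_edge1 // !imsetU !imset_set1 redirect_path_edges //.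
  rewrite !redirect_in // private_u // private_v // CE.
  by rewrite (setUC [set u] [set q]).
case/splitPr: vt ut EC nup nq s3 => t1 t2 ut EC nup nq s3.
(* [r] is the successor of [v] on C; the segment from [r] to [q] is the one to be reversed. *)
have [r [t3 [Er lr]]] : exists r t3, rcons t2 q = r :: t3 /\ last r t3 = q.
  case: t2 {ut EC nup nq s3} => [|r t2]; first by exists q, [::].
  by exists r, (rcons t2 q); rewrite last_rcons.
have lt1 : last p t1 \in p :: t1 by apply: mem_last.
rewrite rcons_cat rcons_cons Er in EC ut nup.
have us' : uniq (u :: p :: t1 ++ v :: rev (r :: t3)).
  apply: etrans ut; apply: perm_uniq; rewrite !perm_cons perm_cat2l perm_cons.
  by rewrite perm_rev.
have [out1 out3] : {in p :: t1, forall y, y \notin [:: u; v]} /\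
    {in r :: t3, forall y, y \notin [:: u; v]}.
  have outu y : y \in p :: t1 ++ v :: r :: t3 -> y != u.
    by move=> yt; apply: contraNneq nup => <-.
  move: ut; rewrite -[u :: _]/([:: u] ++ (p :: t1) ++ _) cat_uniq => /and3P[_ _].
  rewrite cat_uniq => /and3P[_ /hasPn nt1 /andP[nr _]].
  split=> y yt; rewrite !inE negb_or outu /=.
  - by apply: contraTneq yt => ->; apply: nt1; rewrite mem_head.
  - by rewrite -cat_cons mem_cat yt.
  - by apply: contraNneq nr => <-.
  by rewrite -cat_cons mem_cat (in_cons v) yt !orbT.
set P := path_edges p t1; set P' := path_edges r t3; set l := last p t1 in lt1.
have CE : C = [set u; p] |: (P :|: ([set l; v] |: ([set v; r] |: (P' :|: [set [set q;
    u]])))).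
  by rewrite EC cycle_edges_cons // rcons_cons /= -cats1 -catA path_edges_cat /=
    path_edges_cat lr /= setU0.
have DE : cycle_edges (u :: p :: t1 ++ v :: rev (r :: t3)) =
    [set u; p] |: (P :|: ([set l; v] |: ([set v; q] |: (P' :|: [set [set r; u]])))).
  rewrite cycle_edges_cons // rcons_cons /= -cats1 -catA path_edges_cat /=.
  rewrite lastI rev_rcons lr /= path_edges_cat -[in path_edges q _]lr path_edges_rev.
  suff -> : last q (rev (belast r t3)) = r by rewrite /= setU0.
  by rewrite -lr; case: (t3) => //= a b; rewrite rev_cons last_rcons.
(* Being neighbours of [v] in K, [l] and [r] are adjacent in G to both [u] and [v]. So [ru] can
   close the rerouted cycle, and neither vertex is private, so that [redirect] returns their edges
   to [v]. *)
have [Kl Kr] : K v l /\ K v r.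
  have /subsetP sub := CsubK; split; last first.
    by rewrite -mem_edges sub // CE !inE eqxx !orbT.
  by rewrite adj_sym -mem_edges sub // CE !inE eqxx !orbT.
have luv := out1 _ lt1; have ruv := out3 _ (mem_head _ _).
rewrite !kelmans_v // in Kl Kr.
have /andP[ul vl] := Kl; have /andP[ur vr] := Kr.
have [npl npr] : private l = false /\ private r = false.
  by rewrite /private ul vl ur vr !andbF.
exists (cycle_edges (u :: p :: t1 ++ v :: rev (r :: t3))).
  apply: simple_cycle_edges => //.
    by rewrite /= size_cat /= size_rev /= !addnS.
  rewrite DE !subUset !sub1set !mem_edges up vq (adj_sym G l) vl (adj_sym G r) ur /=.
  rewrite andbT !path_edges_kelmans_sub //.
    by apply: subset_trans CsubK; rewrite CE; apply/subsetP => e eP; rewrite !inE eP !orbT.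
  by apply: subset_trans CsubK; rewrite CE; apply/subsetP => e eP; rewrite !inE eP !orbT.
apply: (lift_special puv up vp _ quv vq uq); first by rewrite DE !inE eqxx.
  by rewrite DE (setUC [set q]) !inE eqxx !orbT.
rewrite DE (setUC [set l]) (setUC [set r]) !setDUl !uv_path_edges // !uv_edge1 //.
rewrite !imsetU !imset_set1 !redirect_path_edges // !redirect_in //.
rewrite private_u // (private_v quv) // npl npr CE.
rewrite (setUC [set l]) (setUC [set q]); congr (_ :|: (_ :|: (_ :|: _))).
by rewrite !(setUC P') setUCA.
Qed.

Lemma card_simple_cycles_kelmans : #|simple_cycles K| <= #|simple_cycles G|.
Proof.
apply: leq_trans (leq_imset_card lift _); apply/subset_leq_card/subsetP => C.
by case/simple_cycle_lift => D DG <-; apply: imset_f.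
Qed.

End KelmansAdjacent.

(** * Reduction to a dominating vertex *)

Definition dominating n (G : sgraph n) (z : 'I_n) := forall x, x != z -> G z x.

Lemma degree_lt n (G : sgraph n) x : degree G x < n.
Proof.
have xn : x \notin [set y | G x y] by rewrite inE adj_irrefl.
rewrite -[n in _ < n]card_ord (leq_trans _ (max_card (x |: [set y | G x y]))) //.
by rewrite cardsU1 xn add1n.
Qed.

(** If a vertex [z] of maximum degree is not dominating, connectedness gives an edge [ab] with [a]
    adjacent to [z] and [b] outside the closed neighbourhood of [z]. Some neighbour [c] of [z] other
    than [a] is not adjacent to [a], since otherwise [a] would see [z], [b] and all other neighbours
    of [z], more than the maximum degree. The pair [z], [a] can then be improved. *)
Lemma dominating_or_kelmans n (G : sgraph n) : 0 < n -> connected_graph G ->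
  (exists z, dominating G z) \/
  exists u v x y, [/\ u != v, G u v, x \notin [:: u; v] & y \notin [:: u; v]] /\
    [/\ G u x, ~~ G v x, G v y & ~~ G u y].
Proof.
case: n G => // n G _ Gc.
have [z _ zmax] := @arg_maxnP _ (ord0 : 'I_n.+1) xpredT (degree G) isT.
case: (boolP [forall x, (x != z) ==> G z x]) => [/forallP dz|ndz].
  by left; exists z => x xz; have /implyP := dz x; apply.
right; pose S := [pred y | (y == z) || G z y].
have : ~~ [forall a, forall b, G a b ==> (a \in S) ==> (b \in S)].
  apply: contra ndz => /forallP cl; apply/forallP => x; apply/implyP => xz.
  have clS : closed G S.
    move=> a b ab; have /forallP/(_ b)/implyP/(_ ab)/implyP ab' := cl a.
    have /forallP/(_ a) := cl b; rewrite adj_sym ab /= => /implyP ba'.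
    by apply/idP/idP.
  have := closed_connect clS (Gc z x); rewrite !inE eqxx /=.
  by rewrite (negbTE xz) /= => <-.
rewrite negb_forall => /existsP[a]; rewrite negb_forall => /existsP[b].
rewrite !negb_imply !inE => /and3P[ab aS]; rewrite negb_or => /andP[bz zb].
have za : G z a by case/orP: aS => // /eqP Ea; rewrite -Ea ab in zb.
have az : z != a by apply: contraTneq za => <-; rewrite adj_irrefl.
have ba : b != a by apply: contraTneq ab => ->; rewrite adj_irrefl.
have : ~~ ([set y | G z y] :\ a \subset [set y | G a y]).
  apply/negP => sub; have := zmax a isT.
  have : [set z; b] :|: ([set y | G z y] :\ a) \subset [set y | G a y].
    by rewrite subUset sub andbT; apply/subsetP => y; rewrite !inE
      => /pred2P[]-> //; rewrite adj_sym.
  move/subset_leq_card; rewrite cardsU disjoint_setI0; last first.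
    rewrite disjoints_subset; apply/subsetP => y.
    by rewrite !inE => /pred2P[]->; rewrite ?adj_irrefl ?(negbTE zb) ?andbF.
  have := cardsD1 a [set y | G z y]; rewrite inE za cards0 subn0 cards2 eq_sym bz.
  by rewrite /degree => ->; lia.
case/subsetPn => c; rewrite !inE => /andP[ca zc] nac.
exists z, a, c, b; split=> //; split; rewrite // !inE negb_or ?ba ?bz ?ca ?andbT //.
by apply: contraTneq zc => ->; rewrite adj_irrefl.
Qed.

(** Each improving move raises the sum of squared degrees, which is bounded by n * n^2, so the moves
    stop. Either no move was made or SLEE has strictly grown; a maximal graph will have to be in the
    first case. *)
Lemma kelmans_reduction (R : realType) n (G : sgraph n) : tricyclic G ->
  exists K z, [/\ tricyclic K, dominating K z,
    #|simple_cycles K| <= #|simple_cycles G|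
    & K = G \/ (SLEE R G < SLEE R K)%R].
Proof.
pose mu (G : sgraph n) := \sum_x degree G x ^ 2.
have mu_le H : mu H <= n * n ^ 2.
  rewrite -[n in n * _]card_ord -sum_nat_const; apply: leq_sum => x _.
  by rewrite leq_sqr ltnW // degree_lt.
have [m] := ubnP (n * n ^ 2 - mu G); elim: m G => // m IHm G le_m Gt.
have n0 : 0 < n.
  case: (posnP n) Gt => // n0 [_ GE]; have := sum_degree G; rewrite GE.
  rewrite big1 => [|x]; first by lia.
  by have := ltn_ord x; rewrite {2}n0.
have [[z dz]|[u [v [x [y [[uv Guv xuv yuv] [ux vx vy uy]]]]]]] :=
  dominating_or_kelmans n0 (proj1 Gt).
  by exists G, z; split=> //; left.
have Kt := tricyclic_kelmans uv Guv Gt.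
have [|K [z [KT Kz Kc KS]]] := IHm (kelmans G u v) _ Kt.
  have := sum_sqr_degree_kelmans uv xuv yuv ux vx vy uy.
  have := mu_le (kelmans G u v); rewrite -!/(mu _) => h1 h2; lia.
exists K, z; split; [exact: KT|exact: Kz| |].
  by apply: leq_trans Kc _; apply: card_simple_cycles_kelmans.
right; have lt1 := kelmans_SLEE_lt R uv xuv yuv ux vx vy uy.
by case: KS => [->//|]; apply: Order.POrderTheory.lt_trans.
Qed.

(** * Cones: graphs with a dominating vertex *)

Definition outer_edges n (G : sgraph n) (z : 'I_n) : {set {set 'I_n}} :=
  [set e in edges G | z \notin e].

Section Cone.
Variables (n : nat) (G : sgraph n) (z : 'I_n).
Hypothesis dz : dominating G z.

Lemma dominating_adj x y :
  G x y = (x != y) && [|| x == z, y == z | [set x; y] \in outer_edges G z].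
Proof.
have [->|xy] := eqVneq x y; first by rewrite adj_irrefl.
have [E|xz] := eqVneq x z; first by rewrite E dz // -E eq_sym.
have [->|yz] := eqVneq y z; first by rewrite adj_sym dz.
by rewrite !inE mem_edges !(eq_sym z) (negbTE xz) (negbTE yz) andbT.
Qed.

Lemma card_edges_dominating : #|edges G| = n.-1 + #|outer_edges G z|.
Proof.
rewrite -(cardsID [set e : {set 'I_n} | z \in e] (edges G)); congr (_ + _).
  rewrite -[n in RHS]card_ord -(cardC1 z).
  rewrite -(@card_in_imset _ _ (fun x => [set z; x])); last first.
    move=> x y; rewrite !inE => xz yz /eqP; rewrite set2_eq eqxx /=.
    by rewrite !(eq_sym z) (negbTE yz) /= orbF => /eqP.
  apply: eq_card => e; rewrite !inE; apply/andP/imsetP => [[/edgesP[x [y [xy ->]]]]|].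
    rewrite !inE => /pred2P[]->; [exists y|exists x]; rewrite ?inE //.
    - by apply: contraTneq xy => ->; rewrite adj_irrefl.
    - by apply: contraTneq xy => ->; rewrite adj_irrefl.
    by rewrite setUC.
  by case=> x; rewrite inE => xz ->; rewrite mem_edges dz // !inE eqxx.
by apply: eq_card => e; rewrite !inE andbC.
Qed.

End Cone.

(** * Classification of graphs with three edges *)

Section ThreeEdges.
Variable T : finType.
Implicit Types (E : {set {set T}}) (e : {set T}).

Lemma two_edges e1 e2 : #|e1| = 2 -> #|e2| = 2 -> e1 != e2 ->
  (exists a b c, [/\ uniq [:: a; b; c], e1 = [set a; b] & e2 = [set b; c]]) \/
  (exists a b c d,
     [/\ uniq [:: a; b; c; d], e1 = [set a; b] & e2 = [set c; d]]).
Proof.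
move=> /eqP/cards2P[a [b [ab ->]]] /eqP/cards2P[c [d [cd ->]]].
rewrite set2_eq negb_or !negb_and => ne.
have [Eac|ac] := eqVneq a c.
  rewrite -{}Eac in cd ne *; move: ne; rewrite eqxx /= => /andP[bd _].
  left; exists b, a, d; rewrite (setUC [set b]); split=> //=.
  by rewrite !inE negb_or eq_sym ab bd cd.
have [Ead|ad] := eqVneq a d.
  rewrite -{}Ead in cd ne *; move: ne; rewrite eqxx /= => /andP[_ bc].
  left; exists b, a, c; rewrite (setUC [set b]) (setUC [set c]); split=> //=.
  by rewrite !inE negb_or eq_sym ab bc eq_sym cd.
have [Ebc|bc] := eqVneq b c.
  rewrite -{}Ebc in cd *; left; exists a, b, d; split=> //=.
  by rewrite !inE negb_or ab ad cd.
have [Ebd|bd] := eqVneq b d.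
  rewrite -{}Ebd in cd *; left; exists a, b, c; rewrite (setUC [set c]); split=> //=.
  by rewrite !inE negb_or ab ac eq_sym cd.
by right; exists a, b, c, d; split; rewrite //= !inE !negb_or ab ac ad bc bd cd.
Qed.

Lemma three_edges E : #|E| = 3 -> {in E, forall e, #|e| = 2} ->
  [\/ exists a b c d e f : T, uniq [:: a; b; c; d; e; f] /\
        E = [set [set a; b]; [set c; d]; [set e; f]],
      exists a b c d e : T, uniq [:: a; b; c; d; e] /\
        E = [set [set a; b]; [set b; c]; [set d; e]],
      exists a b c d : T, uniq [:: a; b; c; d] /\
        E = [set [set a; b]; [set b; c]; [set c; d]]
    | (exists a b c d : T, uniq [:: a; b; c; d] /\
        E = [set [set a; b]; [set a; c]; [set a; d]]) \/
      exists a b c : T, uniq [:: a; b; c] /\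
        E = [set [set a; b]; [set a; c]; [set b; c]]].
Proof.
move=> E3 E2.
have [e3 Ee3] : exists e3, e3 \in E by apply/card_gt0P; rewrite E3.
have : #|E :\ e3| == 2 by have := cardsD1 e3 E; rewrite Ee3 E3 add1n => -[<-].
case/cards2P => e1 [e2 [e12 E12]].
have EE : E = [set e1; e2; e3] by rewrite -(setD1K Ee3) E12 setUC.
have [e31 e32] : e3 != e1 /\ e3 != e2.
  have: e3 \notin E :\ e3 by rewrite !inE eqxx.
  by rewrite E12 !inE negb_or => /andP.
have c1 : #|e1| = 2 by apply: E2; rewrite EE !inE eqxx.
have c2 : #|e2| = 2 by apply: E2; rewrite EE !inE eqxx orbT.
have /eqP/cards2P[x [y [xy Exy]]] := E2 _ Ee3.
have perm (f1 f2 f3 : {set T}) : E = [set f1; f2; f3] ->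
    [/\ E = [set f1; f3; f2], E = [set f2; f1; f3], E = [set f2; f3; f1],
        E = [set f3; f1; f2] & E = [set f3; f2; f1]].
  by move=> ->; split; apply/setP => e; rewrite !inE; case: (e == f1); case: (e ==
      f2); case: (e == f3).
have [[a [b [c [abc E1 E2']]]]|[a [b [c [d [abcd E1 E2']]]]]] := two_edges c1 c2 e12.
- rewrite E1 E2' Exy in EE; rewrite Exy E1 in e31; rewrite Exy E2' in e32.
  (* By symmetry of the third edge, its endpoint [x'] is taken on the path a b c. If [y'] is on it
     too, a triangle closes; otherwise [x'] at an end gives P_4 and [x'] in the middle gives
     K_{1,3}. *)
  have wl (x' y' : T) : x' != y' -> [set x'; y'] != [set a; b] -> [set x'; y'] !=
      [set b; c] ->
      E = [set [set a; b]; [set b; c]; [set x'; y']] -> x' \in [:: a; b; c] -> 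
      (exists a b c d : T, uniq [:: a; b; c; d] /\
        E = [set [set a; b]; [set b; c]; [set c; d]]) \/
      (exists a b c d : T, uniq [:: a; b; c; d] /\
        E = [set [set a; b]; [set a; c]; [set a; d]]) \/
      exists a b c : T, uniq [:: a; b; c] /\
        E = [set [set a; b]; [set a; c]; [set b; c]].
    move=> xy' n1 n2 EE' xin.
    have [yin|yout] := boolP (y' \in [:: a; b; c]).
      right; right; exists a, b, c; split=> //.
      have [_ _ _ p4 _] := perm _ _ _ EE'; have [p1 _ _ _ _] := perm _ _ _ EE'.
      suff <- : [set x'; y'] = [set a; c] by exact: p1.
      move: xin yin xy' n1 n2; rewrite !inE !set2_eq.
      by case/or3P => /eqP->; case/or3P => /eqP->; rewrite ?eqxx ?orbT //= => _ _ _;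
          rewrite setUC.
    have uy s : uniq s -> {subset s <= [:: a; b; c]} -> uniq (rcons s y') && uniq (y' :: s).
      move=> us sub; rewrite rcons_uniq us /= us !andbT andbb.
      by apply: contra yout; apply: sub.
    have [uab ubc uac] : [/\ a != b, b != c & a != c].
      by move: abc; rewrite /= !inE negb_or => /and3P[/andP[-> ->] ->].
    move: xin; rewrite !inE => /or3P[]/eqP Ex; rewrite {}Ex in EE' n1 n2 xy'.
    - left; exists y', a, b, c; split.
        by have /andP[] := uy [:: a; b; c] abc (fun x h => h).
      by rewrite (setUC [set y']); have [_ _ _ -> _] := perm _ _ _ EE'.
    - right; left; exists b, a, c, y'; split; last by rewrite (setUC [set b] [set a]).
      have ub : uniq [:: b; a; c] by rewrite /= !inE negb_or eq_sym uab ubc uac.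
      have sb : {subset [:: b; a; c] <= [:: a; b; c]}.
        by move=> w; rewrite !inE orbCA.
      by have /andP[] := uy _ ub sb.
    left; exists a, b, c, y'; split; last by [].
    by have /andP[] := uy [:: a; b; c] abc (fun x h => h).
  have [xin|xout] := boolP (x \in [:: a; b; c]).
    case: (wl x y xy e31 e32 EE xin) => [?|?]; [exact: Or43|exact: Or44].
  have [yin|yout] := boolP (y \in [:: a; b; c]).
    rewrite (setUC [set x]) in EE e31 e32; rewrite eq_sym in xy.
    case: (wl y x xy e31 e32 EE yin) => [?|?]; [exact: Or43|exact: Or44].
  apply: Or42; exists a, b, c, x, y; split=> //.
  rewrite -[_ :: _]/([:: a; b; c] ++ [:: x; y]) cat_uniq abc /= mem_seq1 xy !andbT.
  by rewrite orbF negb_or xout.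
rewrite E1 E2' Exy in EE; rewrite Exy E1 in e31; rewrite Exy E2' in e32.
(* The symmetries of two disjoint edges allow the third edge to be attached at [a']; the reorderings
   [u2], [u3], [u5] in [wl4] reduce the other three positions to this one. *)
have wl (a' b' c' d' x' y' : T) : uniq [:: a'; b'; c'; d'] -> x' != y' ->
    [set x'; y'] != [set a'; b'] -> [set x'; y'] != [set c'; d'] ->
    E = [set [set a'; b']; [set c'; d']; [set x'; y']] -> x' = a' ->
    (exists a b c d e : T, uniq [:: a; b; c; d; e] /\
        E = [set [set a; b]; [set b; c]; [set d; e]]) \/
    exists a b c d : T, uniq [:: a; b; c; d] /\
        E = [set [set a; b]; [set b; c]; [set c; d]].
  move=> u4 xy' n1 n2 EE' Ex; rewrite {}Ex in EE' xy' n1 n2.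
  move: n1 n2; rewrite !set2_eq !eqxx /= negb_or => /andP[yb _] _.
  have Ec : c' \notin [:: a'; b'] /\ d' \notin [:: a'; b'].
    move: u4; rewrite -[[:: a'; _; _; _]]/([:: a'; b'] ++ [:: c'; d']) cat_uniq /=.
    by rewrite orbF negb_or => /and3P[_ /andP[-> ->]].
  have [ca cb] : c' != a' /\ c' != b' by case: Ec; rewrite !inE negb_or => /andP.
  have [da db] : d' != a' /\ d' != b' by case: Ec => _; rewrite !inE negb_or => /andP.
  have ab' : a' != b' by move: u4; rewrite /= !inE !negb_or => /andP[/and3P[]].
  have cd' : c' != d' by move: u4; rewrite /= !inE => /and4P[].
  have [p1 p2 p3 p4 p5] := perm _ _ _ EE'.
  have [Eyc|yc] := eqVneq y' c'.
    right; exists b', a', c', d'; split; last first.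
      by rewrite (setUC [set b']) -Eyc; rewrite Eyc in p1 *.
    by rewrite /= !inE !negb_or !(eq_sym b') ab' cb db !(eq_sym a') ca da cd'.
  have [Eyd|yd] := eqVneq y' d'.
    right; exists b', a', d', c'; split; last first.
      by rewrite (setUC [set b']) (setUC [set d']); rewrite Eyd in p1.
    by rewrite /= !inE !negb_or !(eq_sym b') ab' cb db !(eq_sym a') ca da (eq_sym d') cd'.
  left; exists b', a', y', c', d'; split; last by rewrite (setUC [set b']).
  by rewrite /= !inE !negb_or !(eq_sym b') ab' cb db !(eq_sym a') ca da (eq_sym y'
      a') xy' yb yc yd cd'.
have wl4 x' y' : x' != y' -> [set x'; y'] != [set a; b] -> [set x'; y'] != [set c; d] ->
    E = [set [set a; b]; [set c; d]; [set x'; y']] -> x' \in [:: a; b; c; d] ->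
    (exists a b c d e : T, uniq [:: a; b; c; d; e] /\
        E = [set [set a; b]; [set b; c]; [set d; e]]) \/
    exists a b c d : T, uniq [:: a; b; c; d] /\
        E = [set [set a; b]; [set b; c]; [set c; d]].
  move=> xy' n1 n2 EE'.
  have u2 : uniq [:: b; a; c; d].
    by move: abcd; rewrite /= !inE !negb_or (eq_sym b a)
      => /and4P[/and3P[-> -> ->] /andP[-> ->] -> _].
  have u3 : uniq [:: c; d; a; b] by apply: etrans abcd; exact: (rot_uniq 2 [:: a; b; c; d]).
  have u5 : uniq [:: d; c; a; b].
    by move: u3; rewrite /= !inE !negb_or (eq_sym d c)
      => /and4P[/and3P[-> -> ->] /andP[-> ->] -> _].
  have [_ EE2 _ _ _] := perm _ _ _ EE'.
  rewrite !inE => /or4P[]/eqP Ex.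
  - exact: (wl _ _ _ _ _ _ abcd xy' n1 n2 EE' Ex).
  - by apply: (wl _ _ _ _ _ _ u2 xy' _ n2 _ Ex); rewrite (setUC [set b]).
  - exact: (wl _ _ _ _ _ _ u3 xy' n2 n1 EE2 Ex).
  by apply: (wl _ _ _ _ _ _ u5 xy' _ n1 _ Ex); rewrite (setUC [set d]).
have [xin|xout] := boolP (x \in [:: a; b; c; d]).
  case: (wl4 x y xy e31 e32 EE xin) => [?|?]; [exact: Or42|exact: Or43].
have [yin|yout] := boolP (y \in [:: a; b; c; d]).
  rewrite (setUC [set x]) in EE e31 e32; rewrite eq_sym in xy.
  case: (wl4 y x xy e31 e32 EE yin) => [?|?]; [exact: Or42|exact: Or43].
apply: Or41; exists a, b, c, d, x, y; split=> //.
rewrite -[_ :: _]/([:: a; b; c; d] ++ [:: x; y]) cat_uniq abcd /= mem_seq1 xy !andbT.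
by rewrite orbF negb_or xout.
Qed.

End ThreeEdges.

(** * Counting the simple cycles of a cone *)

Ltac split_uniq u :=
  move: u; rewrite /= !inE !negb_or -?andbA => u;
  repeat (let H := fresh "ne" in move: u => /andP[H u]).

Ltac simpl_neq :=
  rewrite ?set2_eq ?eqxx;
  repeat match goal with H : is_true (?x != ?y) |- _ =>
    progress rewrite ?(negbTE H) ?[y == x]eq_sym ?(negbTE H) end;
  rewrite /= ?orbF ?andbF ?orbT.

Section CycleNeighbours.
Variables (n : nat) (G : sgraph n) (C : {set {set 'I_n}}).
Hypothesis CG : C \in simple_cycles G.

Lemma cycle_other_edge x a : [set x; a] \in C -> exists2 b, b != a & [set x; b] \in C.
Proof.
case/simple_cyclesP: CG => s [s3 _ us ->].
rewrite mem_cycle_edges // => /andP[xs ab].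
have np := next_neq_prev us s3 xs.
case/orP: ab => /eqP->; [exists (prev s x)|exists (next s x)] => //;
by rewrite ?mem_cycle_edges ?xs ?eqxx ?orbT // eq_sym.
Qed.

Lemma cycle_edge_le2 x a b c : [set x; a] \in C -> [set x; b] \in C ->
  [set x; c] \in C -> [|| a == b, a == c | b == c].
Proof.
case/simple_cyclesP: CG => s [s3 _ us ->]; rewrite !mem_cycle_edges //.
by case/andP => _ /orP[]/eqP-> /andP[_ /orP[]/eqP->] /andP[_ /orP[]/eqP->];
  rewrite ?eqxx ?orbT.
Qed.

End CycleNeighbours.

Section ConeCycles.
Variables (n : nat) (G : sgraph n) (z : 'I_n).
Hypothesis dz : dominating G z.
Let E0 := outer_edges G z.

Lemma outer_edge x y : ([set x; y] \in E0) = [&& G x y, x != z & y != z].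
Proof. by rewrite !inE mem_edges negb_or !(eq_sym z). Qed.

Lemma outer_edge_neq x y : [set x; y] \in E0 -> [/\ x != y, x != z & y != z].
Proof.
rewrite outer_edge => /and3P[xy -> ->]; split=> //.
by apply: contraTneq xy => ->; rewrite adj_irrefl.
Qed.

Lemma cycle_outer_edge C x y : C \in simple_cycles G -> [set x; y] \in C ->
  x != z -> y != z -> [set x; y] \in E0.
Proof.
move=> /simple_cycle_sub/subsetP sub /sub xyG xz yz.
by rewrite outer_edge -mem_edges xyG xz.
Qed.

Lemma spoke_cycle C e : C \in simple_cycles G -> e \in C -> e \notin E0 ->
  exists x, [/\ x != z, e = [set z; x] & exists2 y, [set x; y] \in E0 & [set x; y] \in C].
Proof.
move=> CG eC neE; have eG := subsetP (simple_cycle_sub CG) _ eC.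
have [x xz Ee] : exists2 x, x != z & e = [set z; x].
  case/edgesP: eG neE eC => x [y [xy ->]]; rewrite outer_edge xy /= negb_and !negbK.
  have xNy : x != y by apply: contraTneq xy => ->; rewrite adj_irrefl.
  by case/orP => /eqP Ez _; [exists y; rewrite -Ez // eq_sym|exists x; rewrite -Ez //
      setUC].
exists x; split=> //; rewrite Ee setUC in eC.
have [y yz xyC] := cycle_other_edge CG eC.
by exists y => //; apply: (cycle_outer_edge CG).
Qed.

Lemma cycle_outer_ex C : C \in simple_cycles G -> exists2 e, e \in E0 & e \in C.
Proof.
move=> CG; have [s [s3 _ us EC]] := simple_cyclesP _ _ CG.
have [e eC] : exists e, e \in C.
  case: s s3 us EC => [|x s] // _ us ->; exists [set x; next (x :: s) x].
  by apply/imsetP; exists x; rewrite ?inE ?eqxx.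
have [eE|neE] := boolP (e \in E0); first by exists e.
by have [x [_ _ [y]]] := spoke_cycle CG eC neE; exists [set x; y].
Qed.

(** At a leaf [x] of G - z, a cycle arriving through the only outer edge can continue only to
    [z]. *)
Lemma cycle_spoke C x y : C \in simple_cycles G -> [set x; y] \in C ->
    [set x; y] \in E0 -> (forall w, [set x; w] \in E0 -> w = y) ->
  [set z; x] \in C.
Proof.
move=> CG xyC xyE only; have [w wy xwC] := cycle_other_edge CG xyC.
have [_ xz _] := outer_edge_neq xyE.
have [<-|wz] := eqVneq w z; first by rewrite setUC.
by rewrite (only w) ?eqxx // (cycle_outer_edge CG) in wy.
Qed.

(** A spoke [zx] of C comes with an outer edge [xy] of C, which also lies in C'. The second edge of
    C' at [x] must be the spoke: an outer one would belong to C as well and give C three edges at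
    [x]. *)
Lemma cycle_outer_inj : {in simple_cycles G &, forall C C' : {set {set 'I_n}},
  {in E0, forall e, (e \in C) = (e \in C')} -> C = C'}.
Proof.
suff sub (C C' : {set {set 'I_n}}) : C \in simple_cycles G -> C' \in simple_cycles G ->
    {in E0, forall e, (e \in C) = (e \in C')} -> C \subset C'.
  move=> C C' CG C'G EC; apply/eqP; rewrite eqEsubset !sub // => e eE.
  by rewrite EC.
move=> CG C'G EC; apply/subsetP => e eC.
have [eE|neE] := boolP (e \in E0); first by rewrite -EC.
have [x [xz Ee [y xyE xyC]]] := spoke_cycle CG eC neE.
have xyC' : [set x; y] \in C' by rewrite -EC.
have [w wy xwC'] := cycle_other_edge C'G xyC'.
have [Ew|wz] := eqVneq w z; first by rewrite Ee setUC -Ew.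
have xwE := cycle_outer_edge C'G xwC' xz wz.
have xwC : [set x; w] \in C by rewrite EC.
have xzC : [set x; z] \in C by rewrite setUC -Ee.
have [_ _ yz] := outer_edge_neq xyE.
have := cycle_edge_le2 CG xzC xyC xwC.
by rewrite !(eq_sym z) (negbTE yz) (negbTE wz) eq_sym (negbTE wy).
Qed.

Lemma not_spoke x e : e \in E0 -> e == [set z; x] = false.
Proof. by rewrite inE => /andP[_]; apply: contraNF => /eqP->; rewrite !inE eqxx. Qed.

Lemma outer_cycle1 x y : [set x; y] \in E0 ->
  exists2 C, C \in simple_cycles G & {in E0, forall e, (e \in C) = (e == [set x; y])}.
Proof.
move=> xyE; have [xy xz yz] := outer_edge_neq xyE.
have us : uniq [:: z; x; y] by rewrite /= !inE negb_or !(eq_sym z) xz yz xy.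
have EC := cycle_edges_cons us; rewrite /= setU0 in EC.
exists (cycle_edges [:: z; x; y]).
  apply: simple_cycle_edges => //; rewrite EC !subUset !sub1set !mem_edges.
  move: xyE; rewrite outer_edge => /and3P[-> _ _].
  by rewrite (adj_sym G y) !dz.
move=> e eE; rewrite EC !inE (setUC [set y]) !not_spoke //.
by rewrite orbF.
Qed.

Lemma outer_cycle2 x y w : x != w -> [set x; y] \in E0 -> [set y; w] \in E0 ->
  exists2 C, C \in simple_cycles G &
    {in E0, forall e, (e \in C) = (e == [set x; y]) || (e == [set y; w])}.
Proof.
move=> xw xyE ywE; have [xy xz yz] := outer_edge_neq xyE.
have [yw _ wz] := outer_edge_neq ywE.
have us : uniq [:: z; x; y; w].
  by rewrite /= !inE !negb_or !(eq_sym z) xz yz wz xy xw yw.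
have EC := cycle_edges_cons us; rewrite /= setU0 in EC.
exists (cycle_edges [:: z; x; y; w]).
  apply: simple_cycle_edges => //; rewrite EC !subUset !sub1set !mem_edges.
  move: xyE ywE; rewrite !outer_edge => /and3P[-> _ _] /and3P[-> _ _].
  by rewrite (adj_sym G w) !dz.
move=> e eE; rewrite EC !inE (setUC [set w]) !not_spoke //.
by rewrite orbF.
Qed.

Lemma outer_cycle3 x y w :
    [set x; y] \in E0 -> [set y; w] \in E0 -> [set x; w] \in E0 ->
  exists2 C, C \in simple_cycles G & {in E0, forall e,
    (e \in C) = [|| e == [set x; y], e == [set y; w] | e == [set x; w]]}.
Proof.
move=> xyE ywE xwE; have [xy _ _] := outer_edge_neq xyE.
have [yw _ _] := outer_edge_neq ywE; have [xw _ _] := outer_edge_neq xwE.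
have us : uniq [:: x; y; w] by rewrite /= !inE negb_or xy xw yw.
have EC := cycle_edges_cons us; rewrite /= setU0 (setUC [set w]) in EC.
exists (cycle_edges [:: x; y; w]); last by move=> e _; rewrite EC !inE.
apply: simple_cycle_edges => //; rewrite EC !subUset !sub1set !mem_edges.
by move: xyE ywE xwE; rewrite !outer_edge => /and3P[-> _ _] /and3P[-> _ _] /and3P[->].
Qed.

Section Trace.
Variables f1 f2 f3 : {set 'I_n}.
Hypothesis E0E : E0 = [set f1; f2; f3].
(** A cycle of the cone is encoded by the outer edges it uses, so counting cycles becomes listing
    triples of booleans. The realised ones are the paths of G - z, closed up through [z], and the
    triangle of G - z if there is one. *)
Let trace (C : {set {set 'I_n}}) := (f1 \in C, f2 \in C, f3 \in C).

Lemma trace_inj : {in simple_cycles G &, injective trace}.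
Proof.
move=> C C' CG C'G [e1 e2 e3]; apply: cycle_outer_inj => // e.
by rewrite E0E !inE -orbA => /or3P[]/eqP->.
Qed.

Lemma card_cycles_le L : {in simple_cycles G, forall C : {set {set 'I_n}}, trace C \in L} ->
  #|simple_cycles G| <= size L.
Proof.
move=> CL; rewrite -(card_in_imset trace_inj); apply: leq_trans (card_size L).
by apply/subset_leq_card/subsetP => _ /imsetP[C CG ->]; apply: CL.
Qed.

Lemma card_cycles_ge L : uniq L ->
    {in L, forall t, exists2 C, C \in simple_cycles G & trace C = t} ->
  size L <= #|simple_cycles G|.
Proof.
move=> uL LC; rewrite -(card_in_imset trace_inj) -(card_uniqP uL).
apply/subset_leq_card/subsetP => t tL; have [C CG <-] := LC t tL.
exact: imset_f.
Qed.

Lemma trace_nonempty C : C \in simple_cycles G -> trace C != (false, false, false).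
Proof.
move=> CG; have [e eE eC] := cycle_outer_ex CG.
apply: contraTneq eC => -[n1 n2 n3]; move: eE.
by rewrite E0E !inE -orbA => /or3P[]/eqP->; rewrite ?n1 ?n2 ?n3.
Qed.

End Trace.

(** An isolated outer edge in a cycle forces both of its spokes, so a cycle meeting two components
    would have more than two edges at [z]. *)
Lemma card_cycles_3K2 a b c d e f : uniq [:: a; b; c; d; e; f] ->
  E0 = [set [set a; b]; [set c; d]; [set e; f]] -> #|simple_cycles G| = 3.
Proof.
move=> u EE; split_uniq u.
have [m1 m2 m3] : [/\ [set a; b] \in E0, [set c; d] \in E0 & [set e; f] \in E0].
  by rewrite EE !inE !eqxx !orbT.
pose L := [:: (true, false, false); (false, true, false); (false, false, true)].
apply/eqP; rewrite eqn_leq; apply/andP; split.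
  apply: (card_cycles_le EE (L := L)) => C CG; have := trace_nonempty EE CG.
  have s x y := @cycle_spoke C x y CG; rewrite !inE.
  have sa : [set a; b] \in C -> [set z; a] \in C.
    by move=> /s-> // w; rewrite EE !inE; simpl_neq => /eqP.
  have sb : [set a; b] \in C -> [set z; b] \in C.
    by rewrite setUC in m1 *; move=> /s-> // w; rewrite EE !inE; simpl_neq => /eqP.
  have sc : [set c; d] \in C -> [set z; c] \in C.
    by move=> /s-> // w; rewrite EE !inE; simpl_neq => /eqP.
  have sd : [set c; d] \in C -> [set z; d] \in C.
    by rewrite setUC in m2 *; move=> /s-> // w; rewrite EE !inE; simpl_neq => /eqP.
  have se : [set e; f] \in C -> [set z; e] \in C.
    by move=> /s-> // w; rewrite EE !inE; simpl_neq => /eqP.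
  have le2 := @cycle_edge_le2 _ _ _ CG z.
  case: (boolP ([set a; b] \in C)) => [h1|_]; case: (boolP ([set c; d] \in C)) => [h2|_] //;
    case: (boolP ([set e; f] \in C)) => [h3|_] // _; exfalso.
  - by have := le2 _ _ _ (sa h1) (sb h1) (sc h2); simpl_neq.
  - by have := le2 _ _ _ (sa h1) (sb h1) (sc h2); simpl_neq.
  - by have := le2 _ _ _ (sa h1) (sb h1) (se h3); simpl_neq.
  by have := le2 _ _ _ (sc h2) (sd h2) (se h3); simpl_neq.
apply: (card_cycles_ge EE (L := L)) => // t; rewrite !inE => /or3P[]/eqP->.
- have [C CG EC] := outer_cycle1 m1; exists C => //.
  by rewrite !EC //; simpl_neq.
- have [C CG EC] := outer_cycle1 m2; exists C => //.
  by rewrite !EC //; simpl_neq.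
have [C CG EC] := outer_cycle1 m3; exists C => //.
by rewrite !EC //; simpl_neq.
Qed.

Lemma card_cycles_P3K2 a b c d e : uniq [:: a; b; c; d; e] ->
  E0 = [set [set a; b]; [set b; c]; [set d; e]] -> #|simple_cycles G| = 4.
Proof.
move=> u EE; split_uniq u.
have [m1 m2 m3] : [/\ [set a; b] \in E0, [set b; c] \in E0 & [set d; e] \in E0].
  by rewrite EE !inE !eqxx !orbT.
pose L := [:: (true, false, false); (false, true, false); (false, false, true);
  (true, true, false)].
apply/eqP; rewrite eqn_leq; apply/andP; split.
  apply: (card_cycles_le EE (L := L)) => C CG; have := trace_nonempty EE CG.
  have s x y := @cycle_spoke C x y CG; rewrite !inE.
  have sa : [set a; b] \in C -> [set z; a] \in C.
    by move=> /s-> // w; rewrite EE !inE; simpl_neq => /eqP.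
  have sc : [set b; c] \in C -> [set z; c] \in C.
    by rewrite setUC in m2 *; move=> /s-> // w; rewrite EE !inE; simpl_neq => /eqP.
  have sd : [set d; e] \in C -> [set z; d] \in C.
    by move=> /s-> // w; rewrite EE !inE; simpl_neq => /eqP.
  have se : [set d; e] \in C -> [set z; e] \in C.
    by rewrite setUC in m3 *; move=> /s-> // w; rewrite EE !inE; simpl_neq => /eqP.
  have le2 := @cycle_edge_le2 _ _ _ CG z.
  case: (boolP ([set d; e] \in C)) => [h3|_]; last by do 2 case: (_ \in C).
  case: (boolP ([set a; b] \in C)) => [h1|_].
    by have := le2 _ _ _ (sa h1) (sd h3) (se h3); simpl_neq.
  case: (boolP ([set b; c] \in C)) => [h2|_] //.
  by have := le2 _ _ _ (sc h2) (sd h3) (se h3); simpl_neq.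
apply: (card_cycles_ge EE (L := L)) => // t; rewrite !inE => /or4P[]/eqP->.
- have [C CG EC] := outer_cycle1 m1; exists C => //.
  by rewrite !EC //; simpl_neq.
- have [C CG EC] := outer_cycle1 m2; exists C => //.
  by rewrite !EC //; simpl_neq.
- have [C CG EC] := outer_cycle1 m3; exists C => //.
  by rewrite !EC //; simpl_neq.
have ac : a != c by [].
have [C CG EC] := outer_cycle2 ac m1 m2; exists C => //.
by rewrite !EC //; simpl_neq.
Qed.

(** For j in {3, 4, 6, 7}, a lower bound of 5 already forces j to be at least 6. *)
Lemma card_cycles_P4 a b c d : uniq [:: a; b; c; d] ->
  E0 = [set [set a; b]; [set b; c]; [set c; d]] -> 5 <= #|simple_cycles G|.
Proof.
move=> u EE; split_uniq u.
have [m1 m2 m3] : [/\ [set a; b] \in E0, [set b; c] \in E0 & [set c; d] \in E0].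
  by rewrite EE !inE !eqxx !orbT.
pose L := [:: (true, false, false); (false, true, false); (false, false, true);
  (true, true, false); (false, true, true)].
apply: (card_cycles_ge EE (L := L)) => // t; rewrite !inE => /or4P[|||/orP[]]/eqP->.
- have [C CG EC] := outer_cycle1 m1; exists C => //.
  by rewrite !EC //; simpl_neq.
- have [C CG EC] := outer_cycle1 m2; exists C => //.
  by rewrite !EC //; simpl_neq.
- have [C CG EC] := outer_cycle1 m3; exists C => //.
  by rewrite !EC //; simpl_neq.
- have ac : a != c by [].
  have [C CG EC] := outer_cycle2 ac m1 m2; exists C => //.
  by rewrite !EC //; simpl_neq.
have bd : b != d by [].
have [C CG EC] := outer_cycle2 bd m2 m3; exists C => //.
by rewrite !EC //; simpl_neq.
Qed.

(** The full star is the only nonempty trace that is not realised: it would put three edges at [a]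
    in one cycle. *)
Lemma card_cycles_K13 a b c d : uniq [:: a; b; c; d] ->
  E0 = [set [set a; b]; [set a; c]; [set a; d]] -> #|simple_cycles G| = 6.
Proof.
move=> u EE; split_uniq u.
have [m1 m2 m3] : [/\ [set a; b] \in E0, [set a; c] \in E0 & [set a; d] \in E0].
  by rewrite EE !inE !eqxx !orbT.
pose L := [:: (true, false, false); (false, true, false); (false, false, true);
  (true, true, false); (true, false, true); (false, true, true)].
apply/eqP; rewrite eqn_leq; apply/andP; split.
  apply: (card_cycles_le EE (L := L)) => C CG; have := trace_nonempty EE CG.
  rewrite !inE.
  case: (boolP ([set a; b] \in C)) => [h1|_]; case: (boolP ([set a; c] \in C)) => [h2|_] //;
    case: (boolP ([set a; d] \in C)) => [h3|_] // _.
  by have := cycle_edge_le2 CG h1 h2 h3; simpl_neq.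
have [n1 n2 n3] : [/\ b != c, b != d & c != d] by [].
apply: (card_cycles_ge EE (L := L)) => // t.
rewrite !inE => /or4P[|||/or3P[]]/eqP->.
- have [C CG EC] := outer_cycle1 m1; exists C => //.
  by rewrite !EC //; simpl_neq.
- have [C CG EC] := outer_cycle1 m2; exists C => //.
  by rewrite !EC //; simpl_neq.
- have [C CG EC] := outer_cycle1 m3; exists C => //.
  by rewrite !EC //; simpl_neq.
- have m1' : [set b; a] \in E0 by rewrite setUC.
  have [C CG EC] := outer_cycle2 n1 m1' m2; exists C => //.
  by rewrite !EC //; simpl_neq.
- have m1' : [set b; a] \in E0 by rewrite setUC.
  have [C CG EC] := outer_cycle2 n2 m1' m3; exists C => //.
  by rewrite !EC //; simpl_neq.
have m2' : [set c; a] \in E0 by rewrite setUC.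
have [C CG EC] := outer_cycle2 n3 m2' m3; exists C => //.
by rewrite !EC //; simpl_neq.
Qed.

Lemma card_cycles_K3 a b c : uniq [:: a; b; c] ->
  E0 = [set [set a; b]; [set a; c]; [set b; c]] -> #|simple_cycles G| = 7.
Proof.
move=> u EE; split_uniq u.
have [m1 m2 m3] : [/\ [set a; b] \in E0, [set a; c] \in E0 & [set b; c] \in E0].
  by rewrite EE !inE !eqxx !orbT.
pose L := [:: (true, false, false); (false, true, false); (false, false, true);
  (true, true, false); (true, false, true); (false, true, true); (true, true, true)].
apply/eqP; rewrite eqn_leq; apply/andP; split.
  apply: (card_cycles_le EE (L := L)) => C CG; have := trace_nonempty EE CG.
  by rewrite !inE; do 3 case: (_ \in C).
have [n1 n2 n3] : [/\ b != c, a != c & a != b] by [].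
apply: (card_cycles_ge EE (L := L)) => // t.
rewrite !inE => /or4P[|||/or4P[]]/eqP->.
- have [C CG EC] := outer_cycle1 m1; exists C => //.
  by rewrite !EC //; simpl_neq.
- have [C CG EC] := outer_cycle1 m2; exists C => //.
  by rewrite !EC //; simpl_neq.
- have [C CG EC] := outer_cycle1 m3; exists C => //.
  by rewrite !EC //; simpl_neq.
- have m1' : [set b; a] \in E0 by rewrite setUC.
  have [C CG EC] := outer_cycle2 n1 m1' m2; exists C => //.
  by rewrite !EC //; simpl_neq.
- have [C CG EC] := outer_cycle2 n2 m1 m3; exists C => //.
  by rewrite !EC //; simpl_neq.
- have m3' : [set c; b] \in E0 by rewrite setUC.
  have [C CG EC] := outer_cycle2 n3 m2 m3'; exists C => //.
  by rewrite !EC //; simpl_neq.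
have [C CG EC] := outer_cycle3 m1 m3 m2; exists C => //.
by rewrite !EC //; simpl_neq.
Qed.

End ConeCycles.

(** * Comparing cones *)

(** Each list is completed to an enumeration of all vertices, and equal positions are matched.
    Vertices outside [w] have index [size w], so they go to vertices outside [w']. *)
Lemma index_bij n (w w' : seq 'I_n) : uniq w -> uniq w' -> size w = size w' ->
  exists2 f : 'I_n -> 'I_n, bijective f & forall x, index (f x) w' = index x w.
Proof.
move=> uw uw' sw.
pose ext s := s ++ [seq x <- enum 'I_n | x \notin s].
have ext_uniq s : uniq s -> uniq (ext s).
  move=> us; rewrite cat_uniq us filter_uniq ?enum_uniq //= andbT.
  by apply/hasPn => x; rewrite mem_filter => /andP[].
have ext_mem s x : x \in ext s.
  by rewrite mem_cat mem_filter mem_enum /= andbT orbN.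
have ext_size s : uniq s -> size (ext s) = n.
  by move=> us; rewrite -(card_uniqP (ext_uniq _ us)) -[RHS]card_ord;
    apply: eq_card => x; rewrite ext_mem.
have ext_index s x : index x s = minn (index x (ext s)) (size s).
  rewrite index_cat; case: ifP => [|/negbT] xs; last by rewrite memNindex //; lia.
  by move: xs; rewrite -index_mem; lia.
pose f s s' (x : 'I_n) := nth x (ext s') (index x (ext s)).
have fE s s' x : uniq s -> uniq s' -> index (f s s' x) (ext s') = index x (ext s).
  move=> us us'; rewrite /f index_uniq ?ext_uniq //.
  by rewrite (ext_size _ us') -[X in _ < X](ext_size _ us) index_mem.
have fK s s' : uniq s -> uniq s' -> cancel (f s s') (f s' s).
  move=> us us' x; rewrite {1}/f fE // (set_nth_default x) ?nth_index //.
  by rewrite index_mem.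
exists (f w w'); first by exists (f w' w); apply: fK.
by move=> x; rewrite ext_index fE // -sw -ext_index.
Qed.

Lemma eq_index (T : eqType) (x0 x : T) (w : seq T) i : uniq w -> i < size w ->
  (x == nth x0 w i) = (index x w == i).
Proof.
move=> uw iw; apply/eqP/eqP => [->|Ei]; first by rewrite index_uniq.
by rewrite -Ei nth_index // -index_mem Ei.
Qed.

Definition cone_pattern (pat : seq (nat * nat)) (i j : nat) : bool :=
  [|| i == 0, j == 0, (i, j) \in pat | (j, i) \in pat].

(* G is the cone with apex w_0 over the graph with edges w_i w_j, (i, j) in pat,
   together with pendent vertices at w_0. Vertices outside w have index size w,
   which must not occur in pat. *)
Definition has_pattern n (G : sgraph n) pat (w : seq 'I_n) : Prop :=
  uniq w /\ forall x y, G x y = (x != y) && cone_pattern pat (index x w) (index y w).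

Definition pattern_edges n (z : 'I_n) pat (w : seq 'I_n) : seq {set 'I_n} :=
  [seq [set nth z w p.1; nth z w p.2] | p <- pat].

Definition pattern_bound (k : nat) : pred (nat * nat) :=
  [pred p | [&& 0 < p.1, p.1 < p.2 & p.2 < k]].

Lemma pattern_iso n (G H : sgraph n) pat w w' : has_pattern G pat w ->
  has_pattern H pat w' -> size w = size w' -> graph_iso G H.
Proof.
move=> [uw GE] [uw' HE] sw; have [f fb fE] := index_bij uw uw' sw.
by exists f => // x y; rewrite GE HE !fE (inj_eq (bij_inj fb)).
Qed.

Section PatternEdges.
Variables (n : nat) (G : sgraph n) (pat : seq (nat * nat)) (z : 'I_n) (t : seq 'I_n).
Let w := z :: t.
Hypotheses (uw : uniq w) (patw : all (pattern_bound (size w)) pat).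

Lemma mem_pattern_edges x y : ([set x; y] \in pattern_edges z pat w) =
  ((index x w, index y w) \in pat) || ((index y w, index x w) \in pat).
Proof.
elim: pat patw => [|[i j] p IHp] //= /andP[/and3P[/= i0 ij jw] /IHp{}IHp].
have iw := ltn_trans ij jw; rewrite !in_cons set2_eq IHp !xpair_eqE.
rewrite !(eq_index _ _ uw) //.
rewrite -!orbA; congr (_ || _); rewrite orbCA; congr (_ || _).
by rewrite andbC.
Qed.

Lemma outer_has_pattern : dominating G z ->
  outer_edges G z =i pattern_edges z pat w -> has_pattern G pat w.
Proof.
move=> dz EE; split=> // x y; rewrite (dominating_adj dz) EE mem_pattern_edges.
by rewrite /cone_pattern -!(eq_index z _ uw (i := 0)).
Qed.

Lemma has_pattern_outer : has_pattern G pat w ->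
  dominating G z /\ outer_edges G z =i pattern_edges z pat w.
Proof.
move=> [_ GE]; have iz : index z w = 0 by rewrite /= eqxx.
have dz : dominating G z by move=> x xz; rewrite GE eq_sym xz iz.
split=> // e; apply/idP/idP => [|eE].
  rewrite inE => /andP[/edgesP[x [y [xy ->]]]]; rewrite !inE negb_or => /andP[zx zy].
  rewrite mem_pattern_edges; move: xy; rewrite GE /cone_pattern.
  by rewrite -!(eq_index z _ uw (i := 0)) // !(eq_sym _ z) (negbTE zx) (negbTE zy) =>
      /andP[].
have /mapP[[i j] ijp Ee] := eE; have /and3P[/= i0 ij jw] := allP patw _ ijp.
have iw : i < size w by apply: ltn_trans jw.
have xy : nth z w i != nth z w j by rewrite nth_uniq // ltn_eqF.
rewrite Ee outer_edge GE xy /cone_pattern -mem_pattern_edges -[X in X \in _]Ee eE.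
by rewrite !orbT /= !(eq_sym _ z) !(eq_index z z uw) // iz !ltn_eqF // (ltn_trans i0).
Qed.

End PatternEdges.

(** * Kelmans moves computed on patterns *)

Definition pattern_adj pat i j := (i != j) && cone_pattern pat i j.

(** [kelmans_rel] transcribed to indices, so that the effect of a move on a cone is checked by
    evaluation, independently of n. *)
Definition kelmans_pattern pat i j a b :=
  let moved a b := if a == i then pattern_adj pat i b || pattern_adj pat j b
                   else pattern_adj pat i b && pattern_adj pat j b in
  match a \in [:: i; j], b \in [:: i; j] with
  | true, false => moved a b
  | false, true => moved b a
  | _, _ => cone_pattern pat a b
  end.

(* The index k = size w stands for all the vertices outside w. *)
Definition relabel_check k (P : rel nat) pat' s :=
  all (fun a => all (fun b => ((a != b) || (a == k)) ==>
    (P a b == cone_pattern pat' (index a s) (index b s)))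
    (iota 0 k.+1)) (iota 0 k.+1).

Lemma index_map_nth (T : eqType) (z x : T) (w : seq T) s : uniq w ->
  all (fun i => i < size w) s ->
  index x [seq nth z w i | i <- s] = index (index x w) s.
Proof.
move=> uw; elim: s => //= i s IHs /andP[iw /IHs ->].
by rewrite !(eq_sym _ x) (eq_index _ _ uw) // eq_sym (eq_sym i).
Qed.

Lemma has_pattern_relabel n (G : sgraph n) (P : rel nat) z w pat' s : uniq w ->
    (forall x y, G x y = (x != y) && P (index x w) (index y w)) ->
    all (fun m => m < size w) s -> uniq s -> relabel_check (size w) P pat' s ->
  has_pattern G pat' [seq nth z w m | m <- s].
Proof.
move=> uw GE sw us /allP chk; split.
  rewrite map_inj_in_uniq // => a b /(allP sw) aw /(allP sw) bw /eqP.
  by rewrite nth_uniq // => /eqP.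
move=> x y; rewrite GE; have [//|xy] := eqVneq x y.
have ix v : index v w \in iota 0 (size w).+1 by rewrite mem_iota ltnS index_size.
have /allP/(_ _ (ix y))/implyP := chk _ (ix x).
have -> : (index x w != index y w) || (index x w == size w).
  have [xw|xw] := boolP (x \in w); last by rewrite memNindex // eqxx orbT.
  apply/orP; left; apply: contra xy => /eqP Exy; apply/eqP.
  have yw : y \in w by rewrite -index_mem -Exy index_mem.
  by rewrite -(nth_index z xw) Exy nth_index.
by move=> /(_ isT)/eqP; rewrite !index_map_nth // => <-.
Qed.

Section PatternAdjacency.
Variables (n : nat) (G : sgraph n) (pat : seq (nat * nat)) (z : 'I_n) (w : seq 'I_n).
Hypothesis Gw : has_pattern G pat w.
Let uw := proj1 Gw.

Lemma pattern_adj_nth i y : i < size w -> G (nth z w i) y = pattern_adj pat i (index y w).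
Proof.
move=> iw; rewrite (proj2 Gw) index_uniq // /pattern_adj.
by rewrite eq_sym (eq_index _ _ uw) // eq_sym.
Qed.

Lemma kelmans_has_pattern i j pat' s : i < size w -> j < size w ->
    all (fun m => m < size w) s -> uniq s ->
    relabel_check (size w) (kelmans_pattern pat i j) pat' s ->
  has_pattern (kelmans G (nth z w i) (nth z w j)) pat' [seq nth z w m | m <- s].
Proof.
move=> iw jw; apply: has_pattern_relabel => // x y.
have [->|xy] := eqVneq x y; first by rewrite adj_irrefl.
have inE' v : (v \in [:: nth z w i; nth z w j]) = (index v w \in [:: i; j]).
  by rewrite !inE !(eq_index _ _ uw).
rewrite /= /kelmans_rel /kelmans_pattern !inE' !pattern_adj_nth // !(eq_index _ _ uw) //.
by rewrite (proj2 Gw) xy.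
Qed.

Lemma kelmans_pattern_SLEE (R : realType) i j p q pat' s :
    all (fun m => m < size w) [:: i, j, p, q & s] -> uniq s ->
    [&& i != j, p \notin [:: i; j] & q \notin [:: i; j]] ->
    [&& pattern_adj pat i p, ~~ pattern_adj pat j p,
        pattern_adj pat j q & ~~ pattern_adj pat i q] ->
    relabel_check (size w) (kelmans_pattern pat i j) pat' s ->
  exists G' : sgraph n, has_pattern G' pat' [seq nth z w m | m <- s] /\
    (SLEE R G < SLEE R G')%R.
Proof.
move=> /and5P[iw jw pw qw sw] us /and3P[ij pij qij] /and4P[ip jp jq iq] chk.
exists (kelmans G (nth z w i) (nth z w j)); split; first exact: kelmans_has_pattern.
have out m : m < size w -> m \notin [:: i; j] -> nth z w m \notin [:: nth z w i; nth z w j].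
  by move=> mw; rewrite !inE !nth_uniq.
apply: (kelmans_SLEE_lt R _ (out p pw pij) (out q qw qij));
  by rewrite ?nth_uniq // pattern_adj_nth // index_uniq.
Qed.

End PatternAdjacency.

Definition pat_3K2 := [:: (1, 2); (3, 4); (5, 6)].
Definition pat_P3K2 := [:: (1, 2); (2, 3); (4, 5)].
Definition pat_P4 := [:: (1, 2); (2, 3); (3, 4)].
Definition pat_K13 := [:: (1, 2); (1, 3); (1, 4)].
Definition pat_K3 := [:: (1, 2); (1, 3); (2, 3)].

Section Chain.
Variables (R : realType) (n : nat) (G : sgraph n) (w : seq 'I_n).

(** Vertex 4 is moved from 3 to 2, which makes the path 1 2 4 and turns 3 into a pendent vertex,
    dropped from the list. Vertices 2 and 3 are not adjacent, so the cycle count is allowed to rise,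
    and it does. *)
Lemma SLEE_3K2 : size w = 7 -> has_pattern G pat_3K2 w ->
  exists (G' : sgraph n) (w' : seq 'I_n), [/\ has_pattern G' pat_P3K2 w', size w' = 6
      & (SLEE R G < SLEE R G')%R].
Proof.
case: w => // z t sw Gw.
have [|//|//|//||G' [G'w lt]] := @kelmans_pattern_SLEE n G pat_3K2 z (z :: t) Gw
  R 2 3 1 4 pat_P3K2 [:: 0; 1; 2; 4; 5; 6]; rewrite ?sw //.
by exists G', [seq nth z (z :: t) m | m <- [:: 0; 1; 2; 4; 5; 6]].
Qed.

(** Vertex 5 is moved from 4 to the end 3 of the path, and 4 becomes pendent. *)
Lemma SLEE_P3K2 : size w = 6 -> has_pattern G pat_P3K2 w ->
  exists (G' : sgraph n) (w' : seq 'I_n), [/\ has_pattern G' pat_P4 w', size w' = 5 &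
      (SLEE R G < SLEE R G')%R].
Proof.
case: w => // z t sw Gw.
have [|//|//|//||G' [G'w lt]] := @kelmans_pattern_SLEE n G pat_P3K2 z (z :: t) Gw
  R 3 4 2 5 pat_P4 [:: 0; 1; 2; 3; 5]; rewrite ?sw //.
by exists G', [seq nth z (z :: t) m | m <- [:: 0; 1; 2; 3; 5]].
Qed.

(** Vertex 4 is moved from 3 to 2, which becomes the centre of the star; the new list therefore puts
    2 right after the apex. *)
Lemma SLEE_P4 : size w = 5 -> has_pattern G pat_P4 w ->
  exists (G' : sgraph n) (w' : seq 'I_n), [/\ has_pattern G' pat_K13 w', size w' = 5
      & (SLEE R G < SLEE R G')%R].
Proof.
case: w => // z t sw Gw.
have [|//|//|//||G' [G'w lt]] := @kelmans_pattern_SLEE n G pat_P4 z (z :: t) Gw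
  R 2 3 1 4 pat_K13 [:: 0; 2; 1; 3; 4]; rewrite ?sw //.
by exists G', [seq nth z (z :: t) m | m <- [:: 0; 2; 1; 3; 4]].
Qed.

End Chain.

Section PatternGraph.
Variables (n : nat) (pat : seq (nat * nat)) (w : seq 'I_n).

Definition pattern_rel (x y : 'I_n) :=
  (x != y) && cone_pattern pat (index x w) (index y w).

Lemma pattern_rel_sym : symmetric pattern_rel.
Proof.
by move=> x y; rewrite /pattern_rel /cone_pattern eq_sym orbCA; congr (_ && [|| _, _ | _]);
  rewrite orbC.
Qed.

Lemma pattern_rel_irrefl : irreflexive pattern_rel.
Proof. by move=> x; rewrite /pattern_rel eqxx. Qed.

Definition pattern_graph : sgraph n := SGraph pattern_rel_sym pattern_rel_irrefl.

Lemma pattern_graphP : uniq w -> has_pattern pattern_graph pat w.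
Proof. by []. Qed.

End PatternGraph.

(** Only the apex has neighbours outside [w], so every other degree is a sum over [w]. *)
Lemma degree_pattern n (G : sgraph n) pat w z x : has_pattern G pat w ->
    all (pattern_bound (size w)) pat -> 0 < size w -> x != nth z w 0 ->
  degree G x = \sum_(y <- w) G x y.
Proof.
move=> [uw GE] patw w0 xz; rewrite degree_sum [RHS]big_uniq //= [RHS]big_mkcond.
apply: eq_bigr => y _; case: ifP => // /negbT yw; rewrite GE /cone_pattern.
rewrite -!(eq_index z _ uw (i := 0)) // (negbTE xz) (memNindex yw).
have /negbTE-> : y != nth z w 0 by apply: contraNneq yw => ->; apply: mem_nth.
case: (_ != _) => //=; case: orP => // -[] /(allP patw)/and3P[/= _].
  by rewrite ltnn.
by move=> lt ixw; have := ltn_trans lt ixw; rewrite ltnn.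
Qed.

(* Godsil-McKay type switching: with J the 4 x 4 all-ones matrix, J/2 - I is an
   involution that conjugates Q(K_{1,3}) into Q(K_3 + K_1). *)
Section Cospectral.
Variables (R : realType) (n : nat) (G H : sgraph n) (z a b c d : 'I_n).
Let w := [:: z; a; b; c; d].
(** The triangle is placed on [b], [c], [d], with [a] pendent, so that both graphs live on the same
    four-set on which the switching acts. *)
Let pat_H := [:: (2, 3); (2, 4); (3, 4)].
Hypotheses (Gw : has_pattern G pat_K13 w) (Hw : has_pattern H pat_H w).
Let W := [:: a; b; c; d].
Let uw : uniq w := proj1 Gw.
Let uW : uniq W. Proof. by have /andP[] := uw. Qed.

Local Open Scope ring_scope.
Let S : 'M[R]_n := \matrix_(x, y)
  if x \in W then if y \in W then 2^-1 - (x == y)%:R else 0 else (x == y)%:R.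

Let sumW (f : 'I_n -> R) : (forall x, x \notin W -> f x = 0) ->
  \sum_x f x = \sum_(x <- W) f x.
Proof.
move=> f0; rewrite [RHS]big_uniq //= [RHS]big_mkcond; apply: eq_bigr => x _.
by case: ifP => // /negbT; apply: f0.
Qed.

Let mulS (X : 'M[R]_n) x y : (S *m X) x y =
  if x \in W then 2^-1 * \sum_(k <- W) X k y - X x y else X x y.
Proof.
rewrite mxE; have [xW|xW] := boolP (x \in W); last first.
  rewrite (bigD1 x) //= !mxE (negbTE xW) eqxx mul1r big1 ?addr0 // => k kx.
  by rewrite mxE (negbTE xW) eq_sym (negbTE kx) mul0r.
rewrite sumW => [|k /negbTE kW]; last by rewrite mxE xW kW mul0r.
rewrite mulr_sumr.
have -> : X x y = \sum_(k <- W) (x == k)%:R * X k y.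
  rewrite (bigD1_seq x) //= eqxx mul1r big1 ?addr0 // => k kx.
  by rewrite eq_sym (negbTE kx) mul0r.
rewrite -sumrB; apply: eq_big_seq => k kW.
by rewrite mxE xW kW mulrBl.
Qed.

Let mul_S (X : 'M[R]_n) x y : (X *m S) x y =
  if y \in W then 2^-1 * \sum_(k <- W) X x k - X x y else X x y.
Proof.
rewrite mxE; have [yW|yW] := boolP (y \in W); last first.
  have S0 k : S k y = (k == y)%:R.
    rewrite mxE; case: ifP => // kW; rewrite (negbTE yW).
    by case: eqP kW yW => // -> ->.
  rewrite (bigD1 y) //= S0 eqxx mulr1 big1 ?addr0 // => k ky.
  by rewrite S0 (negbTE ky) mulr0.
rewrite sumW => [|k kW]; last first.
  by rewrite mxE (negbTE kW); case: eqP kW => [->|]; rewrite ?yW // mulr0.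
rewrite mulr_sumr.
have -> : X x y = \sum_(k <- W) (k == y)%:R * X x k.
  rewrite (bigD1_seq y) //= eqxx mul1r big1 ?addr0 // => k ky.
  by rewrite (negbTE ky) mul0r.
rewrite -sumrB; apply: eq_big_seq => k kW.
by rewrite mxE kW yW mulrBr !(mulrC (X x k)).
Qed.

Let S2 : S *m S = 1%:M.
Proof.
apply/matrixP => x y; rewrite mulS mxE [RHS]mxE.
have [xW|//] := boolP (x \in W); have [yW|yW] := boolP (y \in W); last first.
  rewrite big1_seq => [|k /= kW]; last by rewrite mxE kW (negbTE yW).
  by case: eqP xW yW => [-> ->//|_ _ _]; rewrite mulr0 subr0.
have -> : \sum_(k <- W) S k y = \sum_(k <- W) (2^-1 - (k == y)%:R).
  by apply: eq_big_seq => k kW; rewrite mxE kW yW.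
have sum1 : \sum_(k <- W) (k == y)%:R = 1 :> R.
  by rewrite (bigD1_seq y) //= eqxx big1 ?addr0 // => k /negbTE->.
by rewrite sumrB sum1 !big_cons big_nil; lra.
Qed.

Let nthW x : x \in W -> exists i, [/\ (0 < i)%N, (i < 5)%N & x = nth z w i].
Proof.
move=> xW; exists (index x W).+1; split=> //; first by rewrite ltnS -[4%N]/(size W)
    index_mem.
by rewrite /= nth_index.
Qed.

Let Q (K : sgraph n) := signless_laplacian R K.

(** The diagonal value counts neighbours among the five listed vertices, which is the full degree
    for every index but that of the apex. *)
Let entry pat (i j : nat) : nat :=
  if i == j then sumn [seq nat_of_bool (pattern_adj pat i k) | k <- iota 0 5]
  else pattern_adj pat i j.

Let QE (K : sgraph n) pat : all (pattern_bound 5) pat -> has_pattern K pat w ->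
  forall i j, (0 < i)%N -> (i < 5)%N -> (j < 5)%N ->
  Q K (nth z w i) (nth z w j) = (entry pat i j)%:R.
Proof.
move=> pb Kw i j i0 i5 j5; rewrite /Q /entry signless_laplacianE nth_uniq //.
case: eqP => _; last by rewrite (pattern_adj_nth z Kw) // index_uniq.
congr (_%:R); rewrite (degree_pattern (z := z) Kw) //; last by rewrite nth_uniq // -lt0n.
rewrite sumnE big_map (big_nth z) -[iota 0 5]/(index_iota 0 5) !big_mkord.
by apply: eq_bigr => k _; rewrite (pattern_adj_nth z Kw) // index_uniq.
Qed.

Let Q_sym (K : sgraph n) x y : Q K x y = Q K y x.
Proof. by rewrite !signless_laplacianE eq_sym adj_sym; case: eqP => // ->. Qed.

Let sumQ (K : sgraph n) pat : all (pattern_bound 5) pat -> has_pattern K pat w ->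
  forall j, (j < 5)%N -> 
  \sum_(k <- W) Q K k (nth z w j) = (sumn [seq entry pat i j | i <- iota 1 4])%:R.
Proof.
move=> pb Kw j j5; rewrite !big_cons big_nil -[a]/(nth z w 1) -[b]/(nth z w 2).
rewrite -[c]/(nth z w 3) -[d]/(nth z w 4) !(QE pb Kw) //.
by rewrite /= !natrD.
Qed.

Let Q_out (K : sgraph n) pat : all (pattern_bound 5) pat -> has_pattern K pat w ->
  forall x y, x \notin W -> Q K x y =
  (if x == y then (if x == z then n.-1 else 1%N) else (x == z) || (y == z) : nat)%:R.
Proof.
move=> pb Kw x y xW; rewrite /Q signless_laplacianE.
have [dz _] := has_pattern_outer uw pb Kw.
have adjx v : x != z -> K x v = (v == z).
  move=> xz; rewrite (proj2 Kw) /cone_pattern.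
  have xw : index x w = 5%N by rewrite memNindex // inE negb_or xz.
  rewrite xw -(eq_index z _ uw (i := 0)) // -[nth z w 0]/z.
  have [->|_] := eqVneq v z; first by rewrite xz.
  have -> : ((5%N, index v w) \in pat) || ((index v w, 5%N) \in pat) = false.
    apply/negP; case/orP => h; have := allP pb _ h; rewrite /pattern_bound /=; lia.
  by rewrite andbF.
case: eqP => [_|/eqP xy].
  have [->|xz] := eqVneq x z.
    rewrite /degree -[n in n.-1]card_ord -(cardC1 z); congr (_%:R); apply: eq_card => v.
    rewrite !inE; have [->|vz] := eqVneq v z; first exact: adj_irrefl.
    exact: dz.
  congr (_%:R); rewrite /degree -(cards1 z); apply: eq_card => v.
  by rewrite !inE adjx.
have [Ez|xz] := eqVneq x z; last by rewrite adjx.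
by rewrite Ez dz // -Ez eq_sym.
Qed.

(** A vertex outside [W] is adjacent to all of [W] or to none of it, and [S] fixes constant vectors
    on [W] because 4/2 - 1 = 1. So S Q(G) = Q(H) S has content only on the block of [W], where it is
    sixteen numerical identities. *)
Lemma SLEE_cospectral : SLEE R G = SLEE R H.
Proof.
have pG : all (pattern_bound 5) pat_K13 by [].
have pH : all (pattern_bound 5) pat_H by [].
apply: (@SLEE_intertwine _ _ _ _ S); first by have /mulmx1_unit[] := S2.
have zE k : (0 < k)%N -> (k < 5)%N -> nth z w k == z = false.
  by move=> k0 k5; rewrite -[X in _ == X]/(nth z w 0) nth_uniq //; case: k k0 k5.
apply/matrixP => x y; rewrite mulS mul_S.
have [xW|xW] := boolP (x \in W); have [yW|yW] := boolP (y \in W).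
- have [i [i0 i5 ->]] := nthW xW; have [j [j0 j5 ->]] := nthW yW.
  rewrite (sumQ pG Gw) // (QE pG Gw) // (QE pH Hw) //.
  under eq_bigr do rewrite -/(Q H) Q_sym; rewrite (sumQ pH Hw) //.
  case: i i0 i5 {xW} => [|[|[|[|[|i]]]]] // _ _; case: j j0 j5 {yW} =>
      [|[|[|[|[|j]]]]] // _ _;
    repeat match goal with |- context [(?e)%:R] =>
      let v := eval vm_compute in e in progress change e with v end; lra.
- have [i [i0 i5 ->]] := nthW xW.
  have yE k : (0 < k)%N -> (k < 5)%N -> y == nth z w k = false.
    by move=> k0 k5; apply: contraNF yW => /eqP->; case: k k0 k5 => [|k] // _ k5;
        exact: (@mem_nth _ z W k k5).
  rewrite -/(Q G) -/(Q H) !(Q_sym _ _ y) !(Q_out pH Hw) // (Q_out pG Gw) //.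
  under eq_bigr do rewrite Q_sym (Q_out pG Gw) //.
  rewrite !big_cons big_nil -[a]/(nth z w 1) -[b]/(nth z w 2) -[c]/(nth z w 3)
      -[d]/(nth z w 4).
  by rewrite !yE // !zE //; case: (y == z) => /=; lra.
- have [j [j0 j5 ->]] := nthW yW.
  have xE k : (0 < k)%N -> (k < 5)%N -> x == nth z w k = false.
    by move=> k0 k5; apply: contraNF xW => /eqP->; case: k k0 k5 => [|k] // _ k5;
        exact: (@mem_nth _ z W k k5).
  rewrite -/(Q G) -/(Q H) (Q_out pG Gw) // (Q_out pH Hw) //.
  under eq_bigr do rewrite (Q_out pH Hw) //.
  rewrite !big_cons big_nil -[a]/(nth z w 1) -[b]/(nth z w 2) -[c]/(nth z w 3)
      -[d]/(nth z w 4).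
  by rewrite !xE // !zE //; case: (x == z) => /=; lra.
by rewrite -/(Q G) -/(Q H) (Q_out pG Gw) // (Q_out pH Hw).
Qed.

End Cospectral.

Lemma SLEE_K13 (R : realType) n (G : sgraph n) w : size w = 5 ->
  has_pattern G pat_K13 w -> exists (G' : sgraph n) (w' : seq 'I_n),
    [/\ has_pattern G' pat_K3 w', size w' = 4 & SLEE R G = SLEE R G'].
Proof.
case: w => [|z [|a [|b [|c [|d []]]]]] // _ Gw.
pose H := pattern_graph [:: (2, 3); (2, 4); (3, 4)] [:: z; a; b; c; d].
have Hw := pattern_graphP _ (proj1 Gw) : has_pattern H _ _.
exists H, [seq nth z [:: z; a; b; c; d] m | m <- [:: 0; 2; 3; 4]]; split; [|by
    []|exact: SLEE_cospectral Gw Hw].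
exact: (@has_pattern_relabel _ H _ z _ pat_K3 _ (proj1 Hw) (proj2 Hw)).
Qed.

(** * Tricyclic cones and their cycle counts *)

Lemma dominating_connected n (G : sgraph n) z : dominating G z -> connected_graph G.
Proof.
move=> dz; have zc x : connect G z x.
  by have [->|/dz/connect1] := eqVneq x z; first exact: connect0.
by move=> x y; apply: connect_trans (zc y); rewrite (sym_connect_sym (adj_sym G)).
Qed.

Section PatternCount.
Variables (n : nat) (G : sgraph n) (pat : seq (nat * nat)) (w : seq 'I_n).
Hypotheses (patw : all (pattern_bound (size w)) pat) (Gw : has_pattern G pat w).

Lemma has_pattern_tricyclic : 0 < size w -> uniq pat -> size pat = 3 -> tricyclic G.
Proof.
case: w Gw patw => // z t Gzt pzt _ upat pat3.
have [dz EE] := has_pattern_outer (proj1 Gzt) pzt Gzt.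
split; first exact: dominating_connected dz.
rewrite (card_edges_dominating dz) (eq_card EE) (card_uniqP _) ?size_map ?pat3.
  by have := ltn_ord z; lia.
rewrite map_inj_in_uniq // => -[i j] [i' j'] /(allP pzt)/and3P[/= i0 ij jw].
move=> /(allP pzt)/and3P[/= i'0 ij' jw'] /eqP.
rewrite set2_eq !nth_uniq ?(proj1 Gzt) ?(ltn_trans ij) ?(ltn_trans ij') //.
by case/orP => /andP[/eqP Ei /eqP Ej]; [rewrite Ei Ej | lia].
Qed.

End PatternCount.

Section PatternCycles.
Variables (n : nat) (G : sgraph n) (w : seq 'I_n).

Lemma card_cycles_pat_3K2 : size w = 7 -> has_pattern G pat_3K2 w ->
  #|simple_cycles G| = 3.
Proof.
case: w => [|z [|a [|b [|c [|d [|e [|f []]]]]]]] // _ Gw.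
have [dz EE] := has_pattern_outer (proj1 Gw) (isT : all (pattern_bound 7) pat_3K2)
    Gw; have /andP[_ ut] := proj1 Gw.
apply: (card_cycles_3K2 dz ut); apply/setP => x; rewrite EE !inE /=.
by rewrite -!orbA.
Qed.

Lemma card_cycles_pat_P3K2 : size w = 6 -> has_pattern G pat_P3K2 w ->
  #|simple_cycles G| = 4.
Proof.
case: w => [|z [|a [|b [|c [|d [|e []]]]]]] // _ Gw.
have [dz EE] := has_pattern_outer (proj1 Gw) (isT : all (pattern_bound 6) pat_P3K2)
    Gw; have /andP[_ ut] := proj1 Gw.
apply: (card_cycles_P3K2 dz ut); apply/setP => x; rewrite EE !inE /=.
by rewrite -!orbA.
Qed.

Lemma card_cycles_pat_P4 : size w = 5 -> has_pattern G pat_P4 w ->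
  5 <= #|simple_cycles G|.
Proof.
case: w => [|z [|a [|b [|c [|d []]]]]] // _ Gw.
have [dz EE] := has_pattern_outer (proj1 Gw) (isT : all (pattern_bound 5) pat_P4) Gw;
    have /andP[_ ut] := proj1 Gw.
apply: (card_cycles_P4 dz ut); apply/setP => x; rewrite EE !inE /=.
by rewrite -!orbA.
Qed.

Lemma card_cycles_pat_K13 : size w = 5 -> has_pattern G pat_K13 w ->
  #|simple_cycles G| = 6.
Proof.
case: w => [|z [|a [|b [|c [|d []]]]]] // _ Gw.
have [dz EE] := has_pattern_outer (proj1 Gw) (isT : all (pattern_bound 5) pat_K13)
    Gw; have /andP[_ ut] := proj1 Gw.
apply: (card_cycles_K13 dz ut); apply/setP => x; rewrite EE !inE /=.
by rewrite -!orbA.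
Qed.

Lemma card_cycles_pat_K3 : size w = 4 -> has_pattern G pat_K3 w ->
  #|simple_cycles G| = 7.
Proof.
case: w => [|z [|a [|b [|c []]]]] // _ Gw.
have [dz EE] := has_pattern_outer (proj1 Gw) (isT : all (pattern_bound 4) pat_K3) Gw;
    have /andP[_ ut] := proj1 Gw.
apply: (card_cycles_K3 dz ut); apply/setP => x; rewrite EE !inE /=.
by rewrite -!orbA.
Qed.

(** Removing the n - 1 spokes from n + 2 edges leaves three outer edges, to which [three_edges]
    applies. *)
Lemma tricyclic_dominating_pattern z : tricyclic G -> dominating G z ->
  exists w : seq 'I_n,
  [\/ has_pattern G pat_3K2 w /\ size w = 7,
      has_pattern G pat_P3K2 w /\ size w = 6,
      has_pattern G pat_P4 w /\ size w = 5
    | has_pattern G pat_K13 w /\ size w = 5 \/ has_pattern G pat_K3 w /\ size w = 4].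
Proof.
case=> _ GE dz; have E3 : #|outer_edges G z| = 3.
  by have := card_edges_dominating dz; rewrite GE; have := ltn_ord z; lia.
have E2 : {in outer_edges G z, forall e : {set 'I_n}, #|e| = 2}.
  move=> e; rewrite inE => /andP[/edgesP[x [y [xy ->]]] _]; rewrite cards2.
  by case: eqP xy => // ->; rewrite adj_irrefl.
have out x y : [set x; y] \in outer_edges G z -> (z != x) && (z != y).
  by case/outer_edge_neq => _; rewrite !(eq_sym z) => -> ->.
have [] := three_edges E3 E2.
- move=> [a [b [c [d [e [f [u EE]]]]]]].
  have [/out/andP[za zb] /out/andP[zc zd] /out/andP[ze zf]] : [/\ [set a; b] \in
      outer_edges G z,
      [set c; d] \in outer_edges G z & [set e; f] \in outer_edges G z].
    by rewrite EE !inE !eqxx !orbT.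
  exists [:: z; a; b; c; d; e; f]; apply: Or41; split=> //.
  apply: outer_has_pattern => //; first by rewrite cons_uniq u !inE !negb_or za zb zc
      zd ze zf.
  by move=> x; rewrite EE !inE /= -!orbA.
- move=> [a [b [c [d [e [u EE]]]]]].
  have [/out/andP[za zb] /out/andP[_ zc] /out/andP[zd ze]] : [/\ [set a; b] \in
      outer_edges G z,
      [set b; c] \in outer_edges G z & [set d; e] \in outer_edges G z].
    by rewrite EE !inE !eqxx !orbT.
  exists [:: z; a; b; c; d; e]; apply: Or42; split=> //.
  apply: outer_has_pattern => //; first by rewrite cons_uniq u !inE !negb_or za zb zc zd ze.
  by move=> x; rewrite EE !inE /= -!orbA.
- move=> [a [b [c [d [u EE]]]]].
  have [/out/andP[za zb] /out/andP[zc zd]] : [set a; b] \in outer_edges G z /\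
      [set c; d] \in outer_edges G z.
    by rewrite EE !inE !eqxx !orbT.
  exists [:: z; a; b; c; d]; apply: Or43; split=> //.
  apply: outer_has_pattern => //; first by rewrite cons_uniq u !inE !negb_or za zb zc zd.
  by move=> x; rewrite EE !inE /= -!orbA.
case=> [[a [b [c [d [u EE]]]]]|[a [b [c [u EE]]]]].
  have [/out/andP[za zb] /out/andP[_ zc] /out/andP[_ zd]] : [/\ [set a; b] \in
      outer_edges G z,
      [set a; c] \in outer_edges G z & [set a; d] \in outer_edges G z].
    by rewrite EE !inE !eqxx !orbT.
  exists [:: z; a; b; c; d]; apply: Or44; left; split=> //.
  apply: outer_has_pattern => //; first by rewrite cons_uniq u !inE !negb_or za zb zc zd.
  by move=> x; rewrite EE !inE /= -!orbA.
have [/out/andP[za zb] /out/andP[_ zc]] : [set a; b] \in outer_edges G z /\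
    [set a; c] \in outer_edges G z.
  by rewrite EE !inE !eqxx !orbT.
exists [:: z; a; b; c]; apply: Or44; right; split=> //.
apply: outer_has_pattern => //; first by rewrite cons_uniq u !inE !negb_or za zb zc.
by move=> x; rewrite EE !inE /= -!orbA.
Qed.

End PatternCycles.

(** * The graphs H_j as cones *)

Section StandardGraphs.
Variable n : nat.

Lemma index_take_enum k (x : 'I_n) : index x (take k (enum 'I_n)) = minn x k.
Proof.
have [le_nk|lt_kn] := leqP n k.
  rewrite take_oversize ?size_enum_ord // index_enum_ord.
  by rewrite (minn_idPl _) // (leq_trans _ le_nk) // ltnW.
have := index_enum_ord x; rewrite -{1}(cat_take_drop k (enum 'I_n)) index_cat.
have sk : size (take k (enum 'I_n)) = k by rewrite size_takel // size_enum_ord ltnW.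
case: ifP => [|/negbT xk]; first by rewrite -index_mem sk => lt <-; lia.
by rewrite (memNindex xk) sk; lia.
Qed.

Lemma pendent_edgesP k i j : ((i, j) \in pendent_edges k n) = (i == 0) && (k <= j < k
    + (n - k)).
Proof.
apply/mapP/andP => [[m mk [-> ->]]|[/eqP-> jk]]; first by rewrite -mem_iota.
by exists j; rewrite // mem_iota.
Qed.

(** All vertices from k on share the index k, so comparing the two adjacencies is a finite check on
    the indices 0, ..., k, settled by evaluation for each H_j. The last two disjuncts stand for the
    pendent edges. *)
Lemma graph_of_edges_pattern k pat es : 0 < k <= n ->
    all (fun i => all (fun j => ((i != j) || (i == k)) ==>
      (cone_pattern pat i j == [|| (i, j) \in es, (j, i) \in es,
        (i == 0) && (j == k) | (j == 0) && (i == k)])) (iota 0 k.+1)) (iota 0 k.+1) ->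
    all (fun p => (p.1 < k) && (p.2 < k)) es ->
  has_pattern (graph_of_edges n (es ++ pendent_edges k n)) pat (take k (enum 'I_n)) /\
    size (take k (enum 'I_n)) = k.
Proof.
case/andP=> k0 kn /allP chk /allP esk; split; last by rewrite size_takel // size_enum_ord.
split; first by rewrite take_uniq ?enum_uniq.
move=> x y; rewrite /= /edge_rel; have [//|xy] := eqVneq x y; rewrite !index_take_enum.
have ix (v : 'I_n) : minn v k \in iota 0 k.+1 by rewrite mem_iota ltnS geq_minr.
have /allP/(_ _ (ix y))/implyP := chk _ (ix x).
have -> : (minn x k != minn y k) || (minn x k == k) by move: xy; rewrite -(inj_eq
    val_inj) /=; lia.
move=> /(_ isT)/eqP ->; rewrite /= !mem_cat !pendent_edgesP.
have esE (i j : 'I_n) : ((minn i k, minn j k) \in es) = ((i : nat, j : nat) \in es).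
  apply/idP/idP => h; have /andP[/= ik jk] := esk _ h;
  have Ei : minn i k = i by [lia]; have Ej : minn j k = j by [lia];
  by rewrite Ei Ej in h *.
rewrite !esE subnKC //; have := ltn_ord x; have := ltn_ord y.
case: (_ \in es) => //=; case: (_ \in es); rewrite ?orbT //= ?orbF.
lia.
Qed.

Lemma H3_pattern : 7 <= n ->
  exists w, has_pattern (H3_graph n) pat_3K2 w /\ size w = 7.
Proof. by move=> hn; exists (take 7 (enum 'I_n)); apply: graph_of_edges_pattern. Qed.

Lemma H4_pattern : 6 <= n ->
  exists w, has_pattern (H4_graph n) pat_P3K2 w /\ size w = 6.
Proof. by move=> hn; exists (take 6 (enum 'I_n)); apply: graph_of_edges_pattern. Qed.

Lemma H6_pattern : 5 <= n ->
  exists w, has_pattern (H6_graph n) pat_K13 w /\ size w = 5.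
Proof. by move=> hn; exists (take 5 (enum 'I_n)); apply: graph_of_edges_pattern. Qed.

Lemma H7_pattern : 4 <= n ->
  exists w, has_pattern (H7_graph n) pat_K3 w /\ size w = 4.
Proof. by move=> hn; exists (take 4 (enum 'I_n)); apply: graph_of_edges_pattern. Qed.

Lemma has_pattern_size (G : sgraph n) pat w : has_pattern G pat w -> size w <= n.
Proof. by case=> uw _; rewrite -(card_uniqP uw) -[n in _ <= n]card_ord max_card. Qed.

End StandardGraphs.

(** * From at most j cycles to exactly j, and the extremal graph *)

(** The cone climbs the chain until its count is j. P_4 is always left for K_{1,3}, and K_{1,3} is
    left for K_3 exactly when j = 7. *)
Lemma dominating_SLEE_le (R : realType) n (K : sgraph n) z j :
    j \in [:: 3; 4; 6; 7] -> tricyclic K -> dominating K z -> #|simple_cycles K| <= j ->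
  exists G' : sgraph n, [/\ tricyclic G', #|simple_cycles G'| = j &
    (SLEE R K <= SLEE R G')%R].
Proof.
move=> hj Kt Kz Kj.
have end_K3 (G : sgraph n) w : j = 7 -> size w = 4 -> has_pattern G pat_K3 w ->
    exists G' : sgraph n, [/\ tricyclic G', #|simple_cycles G'| = j & (SLEE R G <=
        SLEE R G')%R].
  move=> j7 sw Gw; exists G; split; [|by rewrite (card_cycles_pat_K3 sw Gw) j7|exact: lexx].
  by apply: has_pattern_tricyclic Gw _ _ _; rewrite ?sw.
have end_K13 (G : sgraph n) w : 6 <= j -> size w = 5 -> has_pattern G pat_K13 w ->
    exists G' : sgraph n, [/\ tricyclic G', #|simple_cycles G'| = j & (SLEE R G <=
        SLEE R G')%R].
  move=> j6 sw Gw; have [j7|j7] := eqVneq j 7.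
    have [G1 [w1 [G1w1 sw1 ->]]] := SLEE_K13 R sw Gw.
    exact: end_K3 sw1 G1w1.
  exists G; split; [by apply: has_pattern_tricyclic Gw _ _ _; rewrite ?sw| |exact: lexx].
  rewrite (card_cycles_pat_K13 sw Gw).
  by move: hj j6 j7; rewrite !inE => /or4P[]/eqP->.
have end_P4 (G : sgraph n) w : 5 <= j -> size w = 5 -> has_pattern G pat_P4 w ->
    exists G' : sgraph n, [/\ tricyclic G', #|simple_cycles G'| = j & (SLEE R G <=
        SLEE R G')%R].
  move=> j5 sw Gw; have [G1 [w1 [G1w1 sw1 lt1]]] := SLEE_P4 R sw Gw.
  have [|G' [G't G'j le1]] := end_K13 G1 w1 _ sw1 G1w1.
    by move: hj j5; rewrite !inE => /or4P[]/eqP->.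
  by exists G'; split; [exact: G't|exact: G'j|exact: le_trans (ltW lt1) le1].
have end_P3K2 (G : sgraph n) w : 4 <= j -> size w = 6 -> has_pattern G pat_P3K2 w ->
    exists G' : sgraph n, [/\ tricyclic G', #|simple_cycles G'| = j & (SLEE R G <=
        SLEE R G')%R].
  move=> j4 sw Gw; have [E4|j4'] := eqVneq j 4.
    exists G; split; [|by rewrite (card_cycles_pat_P3K2 sw Gw) E4|exact: lexx].
    by apply: has_pattern_tricyclic Gw _ _ _; rewrite ?sw.
  have [G1 [w1 [G1w1 sw1 lt1]]] := SLEE_P3K2 R sw Gw.
  have [|G' [G't G'j le1]] := end_P4 G1 w1 _ sw1 G1w1; first by lia.
  by exists G'; split; [exact: G't|exact: G'j|exact: le_trans (ltW lt1) le1].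
have [w [[Kw sw]|[Kw sw]|[Kw sw]|[[Kw sw]|[Kw sw]]]] := tricyclic_dominating_pattern Kt Kz.
- have [E3|j3] := eqVneq j 3.
    by exists K; split; [exact: Kt|rewrite (card_cycles_pat_3K2 sw Kw) E3|exact: lexx].
  have [G1 [w1 [G1w1 sw1 lt1]]] := SLEE_3K2 R sw Kw.
  have [|G' [G't G'j le1]] := end_P3K2 G1 w1 _ sw1 G1w1.
    by move: Kj; rewrite (card_cycles_pat_3K2 sw Kw); lia.
  by exists G'; split; [exact: G't|exact: G'j|exact: le_trans (ltW lt1) le1].
- by apply: (end_P3K2 _ _ _ sw Kw); move: Kj; rewrite (card_cycles_pat_P3K2 sw Kw).
- by apply: (end_P4 _ _ _ sw Kw); apply: leq_trans Kj; exact: card_cycles_pat_P4 sw Kw.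
- by apply: (end_K13 _ _ _ sw Kw); move: Kj; rewrite (card_cycles_pat_K13 sw Kw).
apply: (end_K3 _ _ _ sw Kw); move: hj Kj; rewrite (card_cycles_pat_K3 sw Kw) !inE.
by case/or4P=> /eqP->.
Qed.

Theorem theorem2p1 (R : realType) (j n : nat) (hj : j \in [:: 3; 4; 6; 7])
    (G : sgraph n) (hG : tricyclic G) (hGj : #|simple_cycles G| = j)
    (hmax : forall G' : sgraph n, tricyclic G' -> #|simple_cycles G'| = j ->
              (SLEE R G' <= SLEE R G)%R) :
  graph_iso G (H_graph j n).
Proof.
have [K [z [Kt Kz Kc KG]]] := kelmans_reduction R hG; rewrite hGj in Kc.
(* Maximality is extended to cones with fewer than j cycles; applied to [K], it rules out a strict
   gain in the reduction, so [G] is itself a cone. *)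
have max (L : sgraph n) y : tricyclic L -> dominating L y -> #|simple_cycles L| <= j ->
    (SLEE R L <= SLEE R G)%R.
  move=> Lt Ly Lj; have [G' [G't G'j le']] := dominating_SLEE_le R hj Lt Ly Lj.
  exact: le_trans le' (hmax _ G't G'j).
case: KG => [EK|lt]; last by have := le_lt_trans (max K z Kt Kz Kc) lt; rewrite ltxx.
rewrite {}EK in Kz => {K Kt Kc}.
(* The listed vertices are distinct, which gives the lower bound on n for which H_j is
   meaningful. *)
have [w [[Gw sw]|[Gw sw]|[Gw sw]|[[Gw sw]|[Gw sw]]]] := tricyclic_dominating_pattern hG Kz;
  have := has_pattern_size Gw; rewrite sw => nw.
- have [w' [Hw' sw']] := H3_pattern nw.
  by rewrite -hGj (card_cycles_pat_3K2 sw Gw); apply: pattern_iso Gw Hw' _; rewrite sw.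
- have [w' [Hw' sw']] := H4_pattern nw.
  by rewrite -hGj (card_cycles_pat_P3K2 sw Gw); apply: pattern_iso Gw Hw' _; rewrite sw.
(* Counting cannot exclude P_4 when j = 6, but the cone over K_{1,3} has at most j cycles and a
   strictly larger SLEE, against maximality. *)
- have [G1 [w1 [G1w1 sw1 lt1]]] := SLEE_P4 R sw Gw.
  have G1t : tricyclic G1 by apply: has_pattern_tricyclic G1w1 _ _ _; rewrite ?sw1.
  case: w1 sw1 G1w1 => // z1 t1 sw1 G1w1.
  have pb : all (pattern_bound (size (z1 :: t1))) pat_K13 by rewrite sw1.
  have [G1z _] := has_pattern_outer (proj1 G1w1) pb G1w1.
  have : (SLEE R G1 <= SLEE R G)%R.
    apply: (max G1 z1 G1t G1z).
    rewrite (card_cycles_pat_K13 sw1 G1w1) -hGj.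
    have := card_cycles_pat_P4 sw Gw; move: hj; rewrite hGj !inE.
    by case/or4P => /eqP->.
  by move/(lt_le_trans lt1); rewrite ltxx.
- have [w' [Hw' sw']] := H6_pattern nw.
  by rewrite -hGj (card_cycles_pat_K13 sw Gw); apply: pattern_iso Gw Hw' _; rewrite sw.
have [w' [Hw' sw']] := H7_pattern nw.
by rewrite -hGj (card_cycles_pat_K3 sw Gw); apply: pattern_iso Gw Hw' _; rewrite sw.
Qed.
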